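(* Let $d_e\le d$ be fixed. There is a quantity $\tau=\tau(D)>0$ (for integers $D>d_e$) satisfying $$\tau=\Theta\left(\frac{\log(D-d_e+1)^{\frac{d-1}{2}}}{2^{D-d_e}\cdot(D-d_e+1)^{d_e}}\right)\quad\text{as }D\to\infty,$$ where the constants in $\Theta(\cdot)$ depend only on $d_e$ and $d$, such that the following holds. Let $f:\mathbb{R}^D\to\mathbb{R}$ be continuous with effective dimension $d_e<D$, with effective subspace $\mathcal{T}$ and constant subspace $\mathcal{T}^\perp$ spanned by the columns of $U=[I_{d_e}\;0]^T\in\mathbb{R}^{D\times d_e}$ and $V=[0\;I_{D-d_e}]^T\in\mathbb{R}^{D\times(D-d_e)}$, respectively, and let $A$ be a $D\times d$ Gaussian matrix. Then for all $\boldsymbol{p}\in\mathcal{X}=[-1,1]^D$, $$\mathbb{P}[(\mathrm{RP}\mathcal{X})\text{ is successful}]\ge\tau>0.$$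
   Context: A function $f:\mathbb{R}^D\to\mathbb{R}$ has effective dimension $d_e$ if there is a linear subspace $\mathcal{T}$ of dimension $d_e$ such that $f(\boldsymbol{x}_\top+\boldsymbol{x}_\perp)=f(\boldsymbol{x}_\top)$ for all $\boldsymbol{x}_\top\in\mathcal{T}$ and $\boldsymbol{x}_\perp\in\mathcal{T}^\perp$, and $d_e$ is the smallest integer with this property. $\mathcal{T}$ and $\mathcal{T}^\perp$ are called the effective and constant subspaces of $f$. A Gaussian matrix is a random matrix with independent $\mathcal{N}(0,1)$ entries. Let $f^*=\min_{\boldsymbol{x}\in\mathcal{X}}f(\boldsymbol{x})$. The reduced problem $(\mathrm{RP}\mathcal{X})$ is: minimize $f(A\boldsymbol{y}+\boldsymbol{p})$ over $\boldsymbol{y}\in\mathbb{R}^d$ subject to $A\boldsymbol{y}+\boldsymbol{p}\in\mathcal{X}$. It is successful if there exists $\boldsymbol{y}^*\in\mathbb{R}^d$ with $f(A\boldsymbol{y}^*+\boldsymbol{p})=f^*$ and $A\boldsymbol{y}^*+\boldsymbol{p}\in\mathcal{X}$. $a(D)=\Theta(b(D))$ as $D\to\infty$ means that there are positive constants $M_1,M_2$ and $D_0$ with $M_1b(D)\le|a(D)|\le M_2b(D)$ for all $D\ge D_0$. $\log(x)^{q}$ denotes $(\log x)^q$. *)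

(* Defs.v *)
From HB Require Import structures.
From mathcomp Require Import all_boot all_order all_algebra.
From mathcomp Require Import all_classical all_reals all_analysis.

Set Implicit Arguments.
Unset Strict Implicit.
Unset Printing Implicit Defensive.

Import Order.TTheory GRing.Theory Num.Theory.
Import numFieldNormedType.Exports.

Local Open Scope classical_set_scope.
Local Open Scope ring_scope.

Definition orth_compl (R : realType) (n : nat) (S : {vspace 'cV[R]_n}) :
    set 'cV[R]_n :=
  [set x | forall t, t \in S -> \sum_i t i ord0 * x i ord0 = 0].

Definition col_space (R : realType) (m n : nat) (M : 'M[R]_(m, n)) :
    {vspace 'cV[R]_m} :=
  <<[seq col j M | j : 'I_n]>>%VS.

Definition constant_along_orth (R : realType) (D : nat) (f : 'cV[R]_D -> R)
    (S : {vspace 'cV[R]_D}) : Prop :=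
  forall xt xp, xt \in S -> orth_compl S xp -> f (xt + xp) = f xt.

Definition effective_dimension (R : realType) (D : nat) (f : 'cV[R]_D -> R)
    (de : nat) : Prop :=
  (exists2 S, \dim S = de & constant_along_orth f S) /\
  (forall e, (exists2 S, \dim S = e & constant_along_orth f S) -> (de <= e)%N).

Definition effective_subspace (R : realType) (D : nat) (f : 'cV[R]_D -> R)
    (S : {vspace 'cV[R]_D}) : Prop :=
  constant_along_orth f S /\ effective_dimension f (\dim S).

(* [I_de; 0]^T is the library's [pid_mx de : 'M_(D, de)]; this is its
   counterpart [0; I_(D - de)]^T. *)
Definition copid_cols (R : realType) (D de : nat) : 'M[R]_(D, D - de) :=
  \matrix_(i < D, j < D - de) (i == de + j :> nat)%:R.

Definition box (R : realType) (D : nat) : set 'cV[R]_D :=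
  [set x | forall i, -1 <= x i ord0 <= 1].

Definition is_minimum (T : Type) (R : realType) (f : T -> R) (S : set T)
    (m : R) : Prop :=
  (f @` S) m /\ lbound (f @` S) m.

Definition RP_successful (R : realType) (D d : nat) (f : 'cV[R]_D -> R)
    (S : set 'cV[R]_D) (p : 'cV[R]_D) (A : 'M[R]_(D, d)) : Prop :=
  exists2 fstar, is_minimum f S fstar &
    exists2 y : 'cV[R]_d, f (A *m y + p) = fstar & S (A *m y + p).

Definition mutually_independent (R : realType) (dO : measure_display)
    (Omega : measurableType dO) (P : probability Omega R) (I : finType)
    (X : I -> {RV P >-> R}) : Prop :=
  forall (J : {set I}) (B : I -> set R),
    (forall i, i \in J -> measurable (B i)) ->
    P (\bigcap_(i in [set` J]) (X i @^-1` B i)) =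
      (\prod_(i in J) P (X i @^-1` B i))%E.

(* The law of an entry is compared with N(0, 1) on measurable sets only:
   the two set functions take unrelated values on non-measurable sets. *)
Definition gaussian_matrix (R : realType) (dO : measure_display)
    (Omega : measurableType dO) (P : probability Omega R) (m n : nat)
    (A : 'M[{RV P >-> R}]_(m, n)) : Prop :=
  (forall i j (B : set R), measurable B ->
     distribution P (A i j) B = normal_prob 0 1 B) /\
  mutually_independent (fun ij : 'I_m * 'I_n => A ij.1 ij.2).

Definition sample (R : realType) (dO : measure_display)
    (Omega : measurableType dO) (P : probability Omega R) (m n : nat)
    (A : 'M[{RV P >-> R}]_(m, n)) (w : Omega) : 'M[R]_(m, n) :=
  \matrix_(i, j) A i j w.

(* Main.v *)
(* Split A into its first de rows B and its remaining m = D - de rows C, and let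
   z be the top part of x* - p, where x* is a minimizer of f in the box. The
   reduced problem succeeds as soon as some y satisfies B y = z and keeps
   C y + p in the box. If |y| <= 2 / x, every row of C does so with probability at
   least (1 - exp (- x^2 / 2) / x) / 2, the worst case being an endpoint p_i = 1 or
   p_i = -1, and the rows of C are independent of each other and of B.

   Such a short y exists when B is close to a rank-one matrix a b^T with z
   proportional to a and |b| close to T, where T^2 = x^2 + 4 de: the other rows may
   deviate from multiples of b by vectors that are almost orthonormal and almost
   orthogonal to b. Drawing the entries of B in a suitable order, each in an
   interval that depends on the previous ones, the product of the interval lengths
   is of order T^(d - 1 - de), while the density is of order exp (- de x^2 / 2).
   Taking x^2 = 2 log (m + 1) - log log (m + 1) + O(1) makes the contribution of C
   of order 2^-m and that of B of order log (m + 1)^((d - 1) / 2) / (m + 1)^de. *)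

Require Import Defs.
From HB Require Import structures.
From mathcomp Require Import all_boot all_order all_algebra.
From mathcomp Require Import all_classical all_reals all_analysis.
From mathcomp Require Import measurable_realfun ring lra.

Set Implicit Arguments.
Unset Strict Implicit.
Unset Printing Implicit Defensive.

Import Order.TTheory GRing.Theory Num.Theory.
Import numFieldNormedType.Exports.

Local Open Scope classical_set_scope.
Local Open Scope ring_scope.

(** * Integrating independent Gaussian entries one at a time *)

(** The joint density of the entries is never written down. Redrawing one entry from N(0, 1)
    preserves expectations, so the indicator of success may be averaged over one entry after
    another, and it suffices to bound the iterated average from below for every starting vector. In
    this form the interval for an entry may depend on all earlier draws, and the vector y, which
    depends on the top block, is a constant by the time the lower rows are drawn. Two demands fix
    the interval lengths. The pivot row b has length about T, so each of its entries but one may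
    range over a length of order T; this is the source of T^(d - 1). The entries that settle |b|^2,
    or the inner product of another row with b, are multiplied by about T and must be confined to a
    length of order 1 / T. The squared norm of every top row then exceeds T^2 by at most a constant,
    so the density loses only a constant factor. *)

Definition cylinders (R : realType) (K : finType) : set (set (K -> R)) :=
  [set A | exists2 B : K -> set R, (forall k, measurable (B k)) &
    A = [set v | forall k, B k (v k)]].

Notation vecspace R K := (g_sigma_algebraType (@cylinders R K)).

Definition upd (R : realType) (K : finType) (v : K -> R) (k : K) (t : R) :
    K -> R := fun i => if i == k then t else v i.

Section Resampling.
Variables (R : realType) (K : finType).
Local Notation V := (vecspace R K).
Implicit Types (v : V) (k : K).

Lemma measurable_coord k : measurable_fun setT (fun v : V => v k).
Proof.
move=> _ B mB; rewrite setTI; apply: sub_sigma_algebra.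
exists (fun i => if i == k then B else setT); first by move=> i; case: ifP.
apply/seteqP; split => v /=; first by move=> Bv i; case: eqP => [->|].
by move=> /(_ k); rewrite eqxx.
Qed.

Lemma measurable_coordP d (T : measurableType d) (f : T -> V) :
  (forall k, measurable_fun setT (fun x => f x k)) -> measurable_fun setT f.
Proof.
move=> mf; have M := @measurability _ _ T V setT f (@cylinders R K) erefl; apply: M.
move=> _ [_ [B mB ->] <-]; rewrite setTI.
rewrite (_ : _ @^-1` _ = \bigcap_(k in [set: K]) ((fun x => f x k) @^-1` B k)).
  apply: fin_bigcap_measurable => // k _.
  by rewrite -[_ @^-1` _]setTI; exact: mf.
by apply/seteqP; split => x /= h k; [move=> _|]; apply: h.
Qed.

Lemma measurable_upd k :
  measurable_fun setT (fun x : R * V => (upd x.2 k x.1 : V)).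
Proof.
apply: measurable_coordP => i; rewrite /upd.
case: (i == k); first exact: measurable_fst.
by apply: measurableT_comp (measurable_coord i) _; exact: measurable_snd.
Qed.

Local Open Scope ereal_scope.

(** The integrated coordinate stays as a dummy argument, so that these operators act on one function
    space and can be composed along any list of keys. *)
Definition resample k (g : V -> \bar R) : V -> \bar R :=
  fun v => \int[normal_prob 0 1]_t g (upd v k t).

Lemma measurable_section_upd k (g : V -> \bar R) v :
  measurable_fun setT g -> measurable_fun setT (fun t : R => g (upd v k t)).
Proof.
move=> mg; apply: (measurableT_comp mg).
by apply: measurable_coordP => i; rewrite /upd; case: (i == k).
Qed.

Lemma measurable_resample k (g : V -> \bar R) :
  (forall v, 0 <= g v) -> measurable_fun setT g ->
  measurable_fun setT (resample k g).
Proof.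
move=> g0 mg.
have mg' := measurableT_comp mg (@measurable_upd k).
by have := @measurable_fun_fubini_tonelli_G _ _ _ _ _ (normal_prob 0 1) _ mg'
  (fun x => g0 _).
Qed.

Lemma resample_ge0 k (g : V -> \bar R) :
  (forall v, 0 <= g v) -> forall v, 0 <= resample k g v.
Proof. by move=> g0 v; apply: integral_ge0 => t _; exact: g0. Qed.

(** The head of the list is the outermost integral: it is drawn first, and later intervals may
    depend on it. *)
Definition iter_resample (ks : seq K) (g : V -> \bar R) := foldr resample g ks.

Lemma iter_resample_ge0 ks (g : V -> \bar R) :
  (forall v, 0 <= g v) -> forall v, 0 <= iter_resample ks g v.
Proof. by move=> g0; elim: ks => //= k ks; exact: resample_ge0. Qed.

Lemma measurable_iter_resample ks (g : V -> \bar R) :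
  (forall v, 0 <= g v) -> measurable_fun setT g ->
  measurable_fun setT (iter_resample ks g).
Proof.
move=> g0 mg; elim: ks => //= k ks IH.
by apply: measurable_resample => //; exact: iter_resample_ge0.
Qed.

Lemma iter_resample_cat ks ls (g : V -> \bar R) :
  iter_resample (ks ++ ls) g = iter_resample ks (iter_resample ls g).
Proof. exact: foldr_cat. Qed.

Section Independence.
Context (dO : measure_display) (Omega : measurableType dO).
Variables (P : probability Omega R) (X : K -> {RV P >-> R}).
Hypothesis X_normal :
  forall k B, measurable B -> distribution P (X k) B = normal_prob 0 1 B.
Hypothesis X_indep : mutually_independent X.

Definition joint (w : Omega) : V := fun k => X k w.

Lemma measurable_joint : measurable_fun setT joint.
Proof. by apply: measurable_coordP => k; exact: measurable_funP. Qed.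

HB.instance Definition _ :=
  isMeasurableFun.Build _ _ _ _ joint measurable_joint.

Lemma joint_cylinder (B : K -> set R) : (forall k, measurable (B k)) ->
  P (joint @^-1` [set v | forall k, B k (v k)]) =
  \prod_(k : K) normal_prob 0 1 (B k).
Proof.
move=> mB; rewrite (_ : _ @^-1` _ =
    \bigcap_(i in [set` [set: K]%SET]) (X i @^-1` B i)); last first.
  apply/seteqP; split => w /= h k; first by move=> _; exact: h.
  by apply: h => /=; rewrite inE.
rewrite X_indep //; apply: eq_big => [k|k _]; first by rewrite inE.
exact: X_normal.
Qed.

(** Replacing one entry by an independent N(0, 1) variable leaves the joint law unchanged, because
    the entries are independent; Tonelli then separates the new variable from the old ones. *)
Lemma expect_resample k (g : V -> \bar R) :
  (forall v, 0 <= g v) -> measurable_fun setT g ->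
  \int[P]_w resample k g (joint w) = \int[P]_w g (joint w).
Proof.
move=> g0 mg.
pose phi (x : R * Omega) : V := upd (joint x.2) k x.1.
have mphi : measurable_fun setT phi.
  apply: measurable_coordP => i; rewrite /phi /upd.
  case: (i == k); first exact: measurable_fst.
  by apply: measurableT_comp measurable_snd; exact: measurable_funP.
have mphi' : measurable_fun [set: (measurableTypeR R * Omega)%type] phi by [].
pose mix0 : {measure set V -> \bar R} :=
   pushforward (@product_measure1 _ _ _ _ _ (normal_prob 0 1) P) phi.
pose mix := mix0 mphi'.
(* Cylinders are stable under intersection and generate the sigma-algebra, so the two laws need to
   be compared on cylinders only. *)
have lawE (A : set V) : measurable A -> distribution P joint A = mix A.
  apply: (@measure_unique _ R V (@cylinders R K) (fun=> setT) erefl) => //.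
  - move=> _ _ [B mB ->] [C mC ->]; exists (fun i => B i `&` C i).
      by move=> i; exact: measurableI.
    apply/seteqP; split => v /=; first by move=> [h1 h2] i.
    by move=> h; split => i; have [] := h i.
  - by move=> _; exists (fun=> setT) => //; apply/seteqP; split.
  - by apply/seteqP; split => // v _; exists 0%N.
  - move=> _ [B mB ->]; rewrite /mix /mix0 /distribution /= /pushforward.
    rewrite [LHS](joint_cylinder mB) [LHS](bigD1 k) //=.
    pose C := [set v : V | forall i, (if i == k then setT else B i) (v i)].
    have mC : measurable (joint @^-1` C).
      rewrite -[joint @^-1` _]setTI; apply: measurable_joint => //.
      apply: sub_sigma_algebra.
      by exists (fun i => if i == k then setT else B i) => // i; case: ifP.
    rewrite (_ : phi @^-1` _ = B k `*` (joint @^-1` C)).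
      have E := @product_measure1E _ _ _ _ _ (normal_prob 0 1) P _ _ (mB k) mC.
      apply: etrans; last exact: (esym E).
      congr (_ * _).
      have mC' i : measurable (if i == k then [set: R] else B i) by case: ifP.
      apply: etrans; last exact: (esym (joint_cylinder mC')).
      rewrite [RHS](bigD1 k) //= eqxx probability_setT mul1e.
      by apply: eq_bigr => i /negbTE ->.
    apply/seteqP; split => -[t w] /=; rewrite /phi /upd /=.
      move=> h; split; first by have := h k; rewrite eqxx.
      by move=> i; have := h i; case: ifP.
    move=> [Bt h] i; case: eqP => [->//|/eqP/negbTE ik].
    by have := h i; rewrite ik.
  - move=> i; apply: le_lt_trans (ltry 1%R).
    by apply: (probability_le1 (distribution P joint)); exact: measurableT.
transitivity (\int[mix]_v g v).
  rewrite ge0_integral_pushforward//= fubini_tonelli2 //.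
  exact: (measurableT_comp mg).
transitivity (\int[distribution P joint]_v g v).
  by apply: eq_measure_integral => A mA _; apply/esym; exact: lawE.
by rewrite ge0_integral_pushforward//=; exact: measurable_joint.
Qed.

Lemma expect_iter_resample ks (g : V -> \bar R) :
  (forall v, 0 <= g v) -> measurable_fun setT g ->
  \int[P]_w iter_resample ks g (joint w) = \int[P]_w g (joint w).
Proof.
move=> g0 mg; elim: ks => //= k ks <-; rewrite expect_resample //.
- exact: iter_resample_ge0.
- exact: measurable_iter_resample.
Qed.

Lemma ge_iter_resample_probability ks (S : set V) (c : R) :
  measurable S -> (forall v, c%:E <= iter_resample ks (EFin \o \1_S) v) ->
  c%:E <= P (joint @^-1` S).
Proof.
move=> mS cS.
have g0 (v : V) : 0 <= (EFin \o (\1_S : V -> R)) v by rewrite lee_fin.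
have mg : measurable_fun setT (EFin \o \1_S : V -> \bar R).
  exact/measurable_EFinP/measurable_indic.
have mJ : measurable (joint @^-1` S).
  by rewrite -[_ @^-1` _]setTI; exact: measurable_joint.
have -> : P (joint @^-1` S) = \int[P]_w (EFin \o \1_S) (joint w).
  by rewrite -(setIT (_ @^-1` _)) -integral_indic.
rewrite -(expect_iter_resample ks g0 mg).
have [c0|c0] := leP 0%R c; last first.
  apply: le_trans (integral_ge0 _ _); first by rewrite lee_fin ltW.
  by move=> w _; exact: iter_resample_ge0.
rewrite (_ : c%:E = \int[P]_w cst c%:E w); last first.
  by rewrite integral_cst // [X in _ * X]probability_setT mule1.
apply: ge0_le_integral => //.
exact: (measurableT_comp (measurable_iter_resample ks g0 mg) measurable_joint).
Qed.

End Independence.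

End Resampling.

(** * Integrals against the normal law as Lebesgue integrals *)

Section NormalIntegral.
Variables (R : realType).
Local Notation mu := (@lebesgue_measure R).
Local Open Scope ereal_scope.
Import HBNNSimple.

Let mpdf (m s : R) : measurable_fun setT (fun x => (normal_pdf m s x)%:E).
Proof. by apply/measurable_EFinP; exact: measurable_normal_pdf. Qed.

Let integral_normal_nnsfun (m s : R) (f : {nnsfun _ >-> R}) :
  \int[normal_prob m s]_x (f x)%:E =
  \int[mu]_x ((f x)%:E * (normal_pdf m s x)%:E).
Proof.
under [LHS]eq_integral do rewrite fimfunE -fsumEFin//.
rewrite [LHS]ge0_integral_fsum//; last 2 first.
  - by move=> r; exact/measurable_EFinP/measurableT_comp.
  - by move=> n x _; rewrite EFinM nnfun_muleindic_ge0.
under [RHS]eq_integral.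
  move=> x _; rewrite fimfunE -fsumEFin// ge0_mule_fsuml => [|r]; last first.
    by rewrite EFinM nnfun_muleindic_ge0.
  over.
rewrite [RHS]ge0_integral_fsum//; last 2 first.
  - move=> r; apply: emeasurable_funM; last exact: mpdf.
    by apply/measurable_EFinP; exact/measurableT_comp.
  - move=> n x _; apply: mule_ge0; first by rewrite EFinM nnfun_muleindic_ge0.
    by rewrite lee_fin normal_pdf_ge0.
apply: eq_fsbigr => r _.
rewrite integralZl_indic_nnsfun// integral_indic// setIT.
have [r0|r0] := leP 0%R r.
  under [RHS]eq_integral do rewrite EFinM -muleA.
  rewrite ge0_integralZl//; first last.
  - by move=> x _; rewrite mule_ge0 ?lee_fin ?normal_pdf_ge0.
  - by apply: emeasurable_funM; [exact/measurable_EFinP|exact: mpdf].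
  congr (_ * _); rewrite /normal_prob [LHS]integral_mkcond.
  by apply: eq_integral => x _; rewrite epatch_indic/= muleC.
have -> : f @^-1` [set r] = set0.
  by apply: preimage10 => -[x _ fx]; move: r0; rewrite -fx ltNge fun_ge0.
rewrite measure0 mule0 indic0; under eq_integral do rewrite mulr0 mul0e.
by rewrite integral0.
Qed.

(** For indicators this is the definition of [normal_prob]; linearity gives simple functions, and
    monotone convergence the rest. *)
Lemma ge0_integral_normal_prob (m s : R) (f : R -> \bar R) :
  measurable_fun setT f -> (forall x, 0 <= f x) ->
  \int[normal_prob m s]_x f x = \int[mu]_x (f x * (normal_pdf m s x)%:E).
Proof.
move=> mf f0.
have mf' : measurable_fun [set: measurableTypeR R] f by [].
pose f_ := nnsfun_approx measurableT mf'.
transitivity (lim (\int[normal_prob m s]_x (f_ n x)%:E @[n --> \oo])).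
  rewrite -monotone_convergence//=.
  - apply: eq_integral => ? /[!inE] xD; apply/esym/cvg_lim => //=.
    exact: cvg_nnsfun_approx.
  - by move=> n; exact/measurable_EFinP/measurable_funTS.
  - by move=> n ? _; rewrite lee_fin.
  - by move=> ? _ ? ? mn; rewrite lee_fin; exact/lefP/nd_nnsfun_approx.
under eq_fun do rewrite integral_normal_nnsfun.
rewrite -monotone_convergence//=.
- apply: eq_integral => x _; apply/cvg_lim => //=.
  by apply: cvgeZr => //; exact: cvg_nnsfun_approx.
- by move=> n; apply: emeasurable_funM; [exact/measurable_EFinP|exact: mpdf].
- by move=> n x _; rewrite mule_ge0 ?lee_fin ?normal_pdf_ge0.
- move=> x _ a b ab; apply: lee_wpmul2r; first by rewrite lee_fin normal_pdf_ge0.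
  by rewrite lee_fin; exact/lefP/nd_nnsfun_approx.
Qed.

End NormalIntegral.

(** * Drawing entries in intervals that depend on earlier draws *)

Section SequentialBoxes.
Variables (R : realType) (K : finType).
Local Notation V := (vecspace R K).
Local Notation mu := (@lebesgue_measure R).
Implicit Types (v : V) (k : K).

Definition agree_off (ks : seq K) (v v' : K -> R) :=
  forall i, i \notin ks -> v' i = v i.

(** [M] is a budget for the sum of squares. Drawing [t] spends [t ^+ 2] of it, and the density
    factor exp (- t^2 / 2) makes up exactly for the reduced budget, so the integrand is bounded
    below by a constant on the interval. *)
Lemma resample_slab k (g : V -> \bar R) v (a L q M : R) :
  (forall v, 0 <= g v)%E -> measurable_fun setT g -> 0 <= L -> 0 <= q ->
  (forall t, a <= t <= a + L ->
    ((q * expR (- (M - t ^+ 2) / 2))%:E <= g (upd v k t))%E) ->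
  ((q * (L * normal_peak 1) * expR (- M / 2))%:E <= resample k g v)%E.
Proof.
move=> g0 mg L0 q0 gq; rewrite /resample ge0_integral_normal_prob//; last first.
  exact: measurable_section_upd.
set c := q * normal_peak 1 * expR (- M / 2).
have c0 : 0 <= c by rewrite !mulr_ge0 ?normal_peak_ge0 ?expR_ge0.
have mpdf : measurable_fun [set: measurableTypeR R]
    (fun t => g (upd v k t) * (normal_pdf 0 1 t)%:E)%E.
  apply: emeasurable_funM; first exact: measurable_section_upd.
  by apply/measurable_EFinP; exact: measurable_normal_pdf.
have pos t : (0 <= g (upd v k t) * (normal_pdf 0 1 t)%:E)%E.
  by rewrite mule_ge0// lee_fin normal_pdf_ge0.
have step1 : ((q * (L * normal_peak 1) * expR (- M / 2))%:E <=
    \int[mu]_(t in `[a, (a + L)%R]) cst c%:E t)%E.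
  rewrite integral_cst//= lebesgue_measure_itv/=; case: ifP => [_|].
    rewrite -EFinB -EFinM lee_fin /c addrAC subrr add0r.
    by rewrite le_eqVlt; apply/orP; left; apply/eqP; ring.
  rewrite lte_fin ltrDl => /negbT; rewrite -leNgt => L1.
  by rewrite mule0 lee_fin (_ : L = 0) ?(mul0r, mulr0)//; apply/le_anti/andP.
apply: (le_trans step1).
have step2 : (\int[mu]_(t in `[a, (a + L)%R]) cst c%:E t <=
    \int[mu]_(t in `[a, (a + L)%R]) (g (upd v k t) * (normal_pdf 0 1 t)%:E))%E.
  apply: ge0_le_integral => //=.
  - exact: measurable_funTS.
  - move=> t; rewrite in_itv/= => /gq gt.
    apply: le_trans (lee_wpmul2r _ gt); last by rewrite lee_fin normal_pdf_ge0.
    rewrite -EFinM lee_fin normal_pdfE ?oner_eq0// /normal_fun /c.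
    rewrite [leRHS](_ : _ = q * normal_peak 1 *
      (expR (- (M - t ^+ 2) / 2) * expR (- (t - 0) ^+ 2 / (1 ^+ 2 *+ 2)))).
      by rewrite -expRD subr0 expr1n (_ : - (M - t ^+ 2) / 2 + _ = - M / 2)//; field.
    by ring.
by apply: (le_trans step2); apply: ge0_subset_integral => //=; exact: measurableT.
Qed.

(** Induction on the keys, handing the budget [M - t ^+ 2] to the remaining draws. The start [l k]
    depends only on entries of strictly smaller rank, which no later draw changes. At the end the
    unspent budget is nonnegative, so its exponential factor is at most 1. *)
Lemma iter_resample_boxes (rk : K -> nat) (l : K -> V -> R) (L : K -> R)
    (g : V -> \bar R) (q : R) (ks : seq K) :
  (forall v, 0 <= g v)%E -> measurable_fun setT g ->
  (forall k, 0 <= L k) -> 0 <= q ->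
  (forall k v v', (forall i, (rk i < rk k)%N -> v i = v' i) -> l k v = l k v') ->
  uniq ks -> pairwise (fun i j => rk i <= rk j)%N ks ->
  forall v M,
  (forall v' : V, agree_off ks v v' ->
    (forall k, k \in ks -> l k v' <= v' k <= l k v' + L k) ->
    \sum_(k <- ks) v' k ^+ 2 <= M /\ (q%:E <= g v')%E) ->
  ((q * (\prod_(k <- ks) (L k * normal_peak 1)) * expR (- M / 2))%:E <=
    iter_resample ks g v)%E.
Proof.
move=> g0 mg L0 q0 ldep; elim: ks => [_ _ v M h|k ks IH].
  have [||] := h v; first by [].
    by [].
  rewrite !big_nil => M0; apply: le_trans; rewrite lee_fin mulr1.
  rewrite ler_piMr// -[leRHS]expR0 ler_expR mulNr oppr_le0.
  by rewrite divr_ge0.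
move=> /= /andP[kks uks] /andP[/allP krk prk] v M h.
rewrite big_cons mulrCA mulrC -mulrA mulrC.
rewrite [X in X%:E](_ : _ = (q * \prod_(j <- ks) (L j * normal_peak 1)) *
   (L k * normal_peak 1) * expR (- M / 2)); last by ring.
apply: (@resample_slab _ _ _ (l k v)) => //.
- exact: iter_resample_ge0.
- exact: measurable_iter_resample.
- rewrite mulr_ge0// big_seq prodr_ge0// => j _.
  by rewrite mulr_ge0 ?normal_peak_ge0.
move=> t lt; apply: IH => // v' agr box.
have v'k : v' k = t by rewrite agr// /upd eqxx.
have agr' : agree_off (k :: ks) v v'.
  move=> i; rewrite inE negb_or => /andP[ik iks].
  by rewrite agr// /upd (negbTE ik).
have [|sumM qg] := h v' agr'.
  move=> j; rewrite inE => /orP[/eqP->|]; last exact: box.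
  rewrite v'k (ldep k v' v)// => i rki; apply: agr'.
  rewrite inE negb_or; apply/andP; split.
    by apply/eqP => ik; rewrite ik ltnn in rki.
  by apply/negP => /krk; rewrite leqNgt rki.
split=> //; move: sumM; rewrite big_cons v'k => sumM.
by rewrite lerBrDl.
Qed.

End SequentialBoxes.

(** * Gaussian measure of intervals *)

Section NormalIntervals.
Variable R : realType.
Local Notation mu := (@lebesgue_measure R).
Implicit Types (a b s x y : R).

Lemma integral_affine (G : R -> R) (c y a b : R) : continuous G -> 0 < y ->
  a <= b ->
  (\int[mu]_(t in `[(c + y * a)%R, (c + y * b)%R]) (G t)%:E =
   \int[mu]_(t in `[a, b]) (G (c + y * t) * y)%:E)%E.
Proof.
move=> cG y0 ab.
pose F (t : R) := c + y * t.
have dF (t : R) : is_derive t 1 F y.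
  by rewrite /F; apply: is_derive_eq; rewrite add0r mul1r [LHS]mulr1.
have F'E : F^`()%classic = cst y.
  by apply/funext => t; rewrite derive1E; have [_ ->] := dF t.
have cF : continuous F.
  by move=> t; apply/differentiable_continuous/derivable1_diffP; case: (dF t).
rewrite (@integration_by_substitution_increasing _ F)//.
- by apply: eq_integral => t _; rewrite F'E.
- by move=> u t _ _ ut; rewrite /F ltrD2l ltr_pM2l.
- by rewrite F'E => t _; exact: cst_continuous.
- by rewrite F'E; exact: is_cvg_cst.
- by rewrite F'E; exact: is_cvg_cst.
- split; first by move=> t _; case: (dF t).
  + exact: cvg_at_right_filter (cF a).
  + exact: cvg_at_left_filter (cF b).
- exact: continuous_subspaceT.
Qed.

Lemma normal_pdf_std a s t : s != 0 ->
  normal_pdf a s (a + s * t) * `|s| = normal_pdf 0 1 t.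
Proof.
move=> s0; rewrite !normal_pdfE ?oner_eq0//.
have -> : normal_peak s = normal_peak 1 / `|s|.
  rewrite /normal_peak expr1n -mulrnAr sqrtrM ?sqr_ge0// sqrtr_sqr mul1r.
  by rewrite invfM mulrC.
have e : - (a + s * t - a) ^+ 2 / (s ^+ 2 *+ 2) = - (t - 0) ^+ 2 / (1 ^+ 2 *+ 2).
  rewrite subr0 expr1n (addrC a) addrK exprMn -[_ *+ 2 in LHS]mulr_natr.
  by rewrite -mulrN -mulf_div divff ?mul1r// sqrf_eq0.
by rewrite /normal_fun e mulrAC divfK ?normr_eq0.
Qed.

Lemma normal_prob_itv_std a s lo hi : 0 < s -> lo <= hi ->
  normal_prob a s `[lo, hi] = normal_prob 0 1 `[(lo - a) / s, (hi - a) / s].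
Proof.
move=> s0 lh; have sn := lt0r_neq0 s0.
have e z : z = a + s * ((z - a) / s) by rewrite mulrCA divff// mulr1 subrKC.
rewrite /normal_prob {1}[lo in LHS]e {1}[hi in LHS]e integral_affine//; last 2 first.
- exact: continuous_normal_pdf.
- by rewrite ler_pM2r ?invr_gt0// lerD2r.
by apply: eq_integral => t _; rewrite -(normal_pdf_std a t sn) gtr0_norm.
Qed.

Lemma normal_pdfN t : normal_pdf 0 1 (- t) = normal_pdf 0 1 t :> R.
Proof. by rewrite !normal_pdfE ?oner_eq0// /normal_fun !subr0 sqrrN. Qed.

Lemma normal_prob_itvN a b : a <= b ->
  normal_prob 0 1 `[- b, - a] = normal_prob 0 1 `[a, b] :> \bar R.
Proof.
move=> ab; rewrite /normal_prob integration_by_substitution_oppr//.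
- by apply: eq_integral => t _ /=; rewrite normal_pdfN.
- by apply: continuous_subspaceT; apply: continuous_normal_pdf; rewrite oner_eq0.
Qed.

Let mpdf a s : measurable_fun [set: measurableTypeR R]
  (fun t => (normal_pdf a s t)%:E).
Proof. by apply/measurable_EFinP; exact: measurable_normal_pdf. Qed.

Lemma normal_prob_itv_cat a b c : a <= b -> b <= c ->
  (normal_prob 0 1 `[a, c] = normal_prob 0 1 `[a, b] + normal_prob 0 1 `[b, c]
    :> \bar R)%E.
Proof.
move=> ab bc; rewrite (itv_bndbnd_setU (x := BRight b)) ?bnd_simp//.
rewrite /normal_prob ge0_integral_setU//=.
- by congr (_ + _)%E; rewrite integral_itv_obnd_cbnd//; apply: measurable_funTS; exact: mpdf.
- by apply: measurable_funTS; exact: mpdf.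
- by move=> t _; rewrite lee_fin normal_pdf_ge0.
- apply/disj_setPS => t []/=; rewrite !in_itv/= => /andP[_ tb] /andP[bt _].
  by rewrite ltNge tb in bt.
Qed.

(** The density decreases on the nonnegative half-line. *)
Lemma normal_prob_itv_shift b c : 0 <= b -> 0 <= c ->
  (normal_prob 0 1 `[c, (c + b)%R] <= normal_prob 0 1 `[0%R, b])%E.
Proof.
move=> b0 c0; rewrite /normal_prob.
have := @integral_affine (normal_pdf 0 1) c 1 0 b _ ltr01 b0.
rewrite mulr0 addr0 mul1r => ->; last by apply: continuous_normal_pdf; rewrite oner_eq0.
have mc : measurable_fun [set: measurableTypeR R]
    (fun t => (normal_pdf 0 1 (c + 1 * t) * 1)%:E).
  apply/measurable_EFinP; apply: measurable_funM => //.
  apply: measurableT_comp; first exact: measurable_normal_pdf.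
  by apply: measurable_funD => //; exact: measurable_funM.
apply: ge0_le_integral => //=.
- by move=> t _; rewrite lee_fin mulr1 normal_pdf_ge0.
- by apply: measurable_funTS; exact: mc.
- by apply: measurable_funTS; exact: mpdf.
move=> t; rewrite in_itv/= => /andP[t0 _]; rewrite mulr1 mul1r lee_fin.
rewrite !normal_pdfE ?oner_eq0// ler_wpM2l ?normal_peak_ge0//.
rewrite /normal_fun ler_expR !subr0 !mulNr lerN2 ler_wpM2r ?invr_ge0//.
by rewrite lerXn2r ?nnegrE ?addr_ge0// lerDr.
Qed.

(** On the tail t / x >= 1, and t times the density has minus the density as a primitive. *)
Lemma normal_prob_tail x : 0 < x ->
  (normal_prob 0 1 `[x, +oo[ <= (normal_pdf 0 1 x / x)%:E)%E.
Proof.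
move=> x0.
pose f t := t / x * normal_pdf 0 1 t.
pose F t := - (normal_pdf 0 1 t / x).
have pdfE t : normal_pdf 0 1 t = normal_peak 1 * expR (- (t ^+ 2 / 2)) :> R.
  by rewrite normal_pdfE ?oner_eq0// /normal_fun subr0 expr1n mulNr.
have dF (t : R) : is_derive t 1 F (f t).
  pose h (u : R) := - (u ^+ 2 / 2).
  have dh : is_derive t 1 h (- t).
    rewrite /h; apply: is_derive_eq; rewrite !scaler0 add0r.
    by rewrite /GRing.scale/=; lra.
  have dE := is_derive1_comp (is_derive_expR (h t)) dh.
  have -> : F = (fun u => (- (normal_peak 1 / x)) * (expR \o h) u).
    by apply/funext => u; rewrite /F pdfE /= mulrAC mulNr.
  by apply: is_derive_eq; rewrite /f pdfE /GRing.scale/= /h; ring.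
have cF : continuous F.
  by move=> t; apply/differentiable_continuous/derivable1_diffP; case: (dF t).
have cf : continuous f.
  move=> t; apply: cvgM; first by apply: cvgM; [exact: cvg_id|exact: cvg_cst].
  by apply: continuous_normal_pdf; rewrite oner_eq0.
have intf : (\int[mu]_(t in `[x, +oo[) (f t)%:E = 0%:E - (F x)%:E)%E.
  apply: ge0_continuous_FTC2y.
  - move=> t xt; rewrite mulr_ge0 ?normal_pdf_ge0// divr_ge0 ?(ltW x0)//.
    exact: le_trans (ltW x0) xt.
  - exact: continuous_subspaceT.
  - rewrite -[X in _ --> X]oppr0; apply: cvgN.
    rewrite -[X in _ --> X](mul0r x^-1); apply: cvgMl.
    have -> : normal_pdf 0 1 = (fun t : R => normal_peak 1 * expR (- (t ^+ 2 / 2))).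
      by apply/funext => t; exact: pdfE.
    rewrite -[X in _ --> X](mulr0 (normal_peak 1)); apply: cvgMr.
    apply: (cvg_comp (fun t : R => t ^+ 2 / 2) (fun t => expR (- t))).
      by apply/gt0_cvgMly; [rewrite invr_gt0|exact: cvgr_expr2].
    exact: cvgr_expR.
  - by move=> t _; case: (dF t).
  - exact: cvg_at_right_filter (cF x).
  - by move=> t _; rewrite derive1E; have [_ ->] := dF t.
rewrite (_ : (_ / x)%:E = 0%:E - (F x)%:E)%E; last first.
  by rewrite -EFinB sub0r opprK.
rewrite -intf; apply: ge0_le_integral => //=.
- by move=> t _; rewrite lee_fin normal_pdf_ge0.
- by apply: measurable_funTS; exact: mpdf.
- apply/measurable_EFinP; apply: measurable_funTS; exact: continuous_measurable_fun.
move=> t; rewrite in_itv/= andbT => xt; rewrite lee_fin /f.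
by rewrite ler_peMl ?normal_pdf_ge0// ler_pdivlMr// mul1r.
Qed.

Lemma normal_peak1_le : normal_peak 1 <= 2^-1 :> R.
Proof.
have ppi : 0 < (pi : R) *+ 2 by rewrite mulrn_wgt0// pi_gt0.
rewrite /normal_peak expr1n mul1r lef_pV2 ?posrE ?sqrtr_gt0//.
rewrite -[leLHS]ger0_norm// -sqrtr_sqr ler_wsqrtr//.
by have := @pi_ge2 R; rewrite expr2; lra.
Qed.

Lemma normal_prob_itv0y : normal_prob 0 1 `[0%R, +oo[ = 2^-1%:E :> \bar R.
Proof.
have := integral_normal_pdf (0 : R) 1.
rewrite ge0_symfun_integralT//; first last.
- by move=> t /=; rewrite normal_pdfN.
- by apply: continuous_normal_pdf; rewrite oner_eq0.
- by move=> t; exact: normal_pdf_ge0.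
rewrite (_ : [set x | _] = `[0, +oo[%classic); last first.
  by apply/seteqP; split => x/=; rewrite in_itv/= andbT.
rewrite /normal_prob; set I := (X in (_ * X)%E) => E.
transitivity (2^-1%:E * (2%:E * I))%E; last by rewrite E mule1.
by rewrite muleA -EFinM mulVf// mul1e.
Qed.

Lemma normal_prob_itv0_ge x : 0 < x ->
  ((2^-1 * (1 - expR (- x ^+ 2 / 2) / x))%:E <= normal_prob 0 1 `[0%R, x])%E.
Proof.
move=> x0.
have tail : (normal_prob 0 1 `[x, +oo[ <= (2^-1 * (expR (- x ^+ 2 / 2) / x))%:E)%E.
  apply: (le_trans (normal_prob_tail x0)); rewrite lee_fin mulrA.
  rewrite ler_wpM2r ?invr_ge0 ?(ltW x0)// normal_pdfE ?oner_eq0//.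
  by rewrite /normal_fun subr0 expr1n ler_wpM2r ?expR_ge0 ?normal_peak1_le.
have : (normal_prob 0 1 `[0%R, +oo[ <=
    normal_prob 0 1 `[0%R, x] + normal_prob 0 1 `[x, +oo[)%E.
  rewrite (itv_bndbnd_setU (x := BRight x)) ?bnd_simp ?(ltW x0)//.
  apply: le_trans (measureU2 _ _ _) _ => //=.
  rewrite leeD2l// le_measure ?inE//=.
  by move=> t /=; rewrite !in_itv/= !andbT => /ltW.
rewrite normal_prob_itv0y => half.
rewrite mulrBr mulr1 EFinB leeBlDr//; apply: le_trans half _.
by rewrite leeD2l.
Qed.

(* The worst mean in [[-1, 1]] is an endpoint: splitting at the mean, reflection
   and a shift towards the mode only increase the mass. *)
Lemma normal_prob_unit_ge p s x : `|p| <= 1 -> 0 < s -> 0 < x -> s * x <= 2 ->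
  ((2^-1 * (1 - expR (- x ^+ 2 / 2) / x))%:E <= normal_prob p s `[(- 1)%R, 1%R])%E.
Proof.
rewrite ler_norml => /andP[p1 p2] s0 x0 sx.
rewrite normal_prob_itv_std//.
set b := (p + 1) / s; set c := (1 - p) / s.
have b0 : 0 <= b by rewrite divr_ge0 ?(ltW s0)//; lra.
have c0 : 0 <= c by rewrite divr_ge0 ?(ltW s0)//; lra.
have -> : (- 1 - p) / s = - b by rewrite /b -mulNr opprD addrC.
have xbc : x <= c + b.
  rewrite /b /c -mulrDl ler_pdivlMr// mulrC (le_trans sx)//; lra.
apply: (le_trans (normal_prob_itv0_ge x0)).
apply: (@le_trans _ _ (normal_prob 0 1 `[0%R, (c + b)%R])).
  apply: le_measure; rewrite ?inE//= => t /=.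
  by rewrite !in_itv/= => /andP[-> /le_trans]; apply.
rewrite (normal_prob_itv_cat (b := c)) ?lerDl//.
rewrite (@normal_prob_itv_cat (- b) 0 c)// ?oppr_le0// addeC leeD2r//.
have := normal_prob_itvN b0; rewrite oppr0 => ->; exact: normal_prob_itv_shift.
Qed.

End NormalIntervals.

(** * Normal laws with a normally distributed mean *)

Section NormalConvolution.
Variable R : realType.
Local Notation mu := (@lebesgue_measure R).
Implicit Types (a s y lo hi : R).

Lemma normal_prob_affine a y lo hi : y != 0 -> lo <= hi ->
  normal_prob 0 1 [set t | lo <= a + y * t <= hi] =
  normal_prob a `|y| `[lo, hi].
Proof.
move=> y0 lh; rewrite normal_prob_itv_std ?normr_gt0//.
move: y0; rewrite neq_lt => /orP[y0|y0].
  rewrite (ltr0_norm y0) -normal_prob_itvN; last first.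
    by rewrite ler_pM2r ?invr_gt0 ?oppr_gt0// lerD2r.
  congr normal_prob; apply/seteqP; split => t /=; rewrite in_itv/= !invrN !mulrN !opprK.
    by rewrite ler_ndivrMr// ler_ndivlMr// mulrC => /andP[? ?]; apply/andP; split; lra.
  by rewrite ler_ndivrMr// ler_ndivlMr// mulrC => /andP[? ?]; apply/andP; split; lra.
rewrite (gtr0_norm y0).
congr normal_prob; apply/seteqP; split => t /=; rewrite in_itv/=.
  by rewrite ler_pdivrMr// ler_pdivlMr// mulrC => /andP[? ?]; apply/andP; split; lra.
by rewrite ler_pdivrMr// ler_pdivlMr// mulrC => /andP[? ?]; apply/andP; split; lra.
Qed.

(** Completing the square: the joint density of (t, u) is factored once as t followed by u given t,
    and once as u followed by t given u. *)
Lemma normal_pdf_mul (a s y t u : R) : s != 0 ->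
  let w := Num.sqrt (s ^+ 2 + y ^+ 2) in
  normal_pdf (a + y * t) s u * normal_pdf 0 1 t =
  normal_pdf a w u * normal_pdf (y * (u - a) / w ^+ 2) (s / w) t.
Proof.
move=> s0 w.
have s2 : 0 < s ^+ 2 by rewrite exprn_even_gt0.
have w2E : w ^+ 2 = s ^+ 2 + y ^+ 2.
  by rewrite sqr_sqrtr// addr_ge0 ?sqr_ge0.
have w2 : 0 < w ^+ 2 by rewrite w2E ltr_wpDr ?sqr_ge0.
have w0 : w != 0 by rewrite -sqrf_eq0 gt_eqF.
have sw0 : s / w != 0 by rewrite mulf_neq0 ?invr_eq0.
rewrite !normal_pdfE ?oner_eq0// mulrACA [RHS]mulrACA; congr (_ * _).
  rewrite /normal_peak -!invfM; congr (_^-1).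
  rewrite -!sqrtrM; [|by rewrite mulrn_wge0// mulr_ge0 ?sqr_ge0 ?pi_ge0..].
  congr Num.sqrt; rewrite expr1n mul1r expr_div_n !mulr2n.
  set A := w ^+ 2 in w2 *; set B := s ^+ 2 in s2 *; set C := pi : R.
  have A0 : A != 0 by rewrite gt_eqF.
  rewrite [RHS](_ : _ = (A / A) * ((B * C + B * C) * (C + C))); last by ring.
  by rewrite divff// mul1r.
rewrite /normal_fun -!expRD; congr expR.
rewrite expr_div_n expr1n subr0 !mulr2n w2E.
rewrite w2E in w2.
set A := s ^+ 2 in s2 w2 *.
have A0 : A != 0 by rewrite gt_eqF.
have B0 : A + y ^+ 2 != 0 by rewrite gt_eqF.
by field; rewrite B0 -!mulr2n !mulrn_eq0 /= A0 B0.
Qed.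

Lemma measurable_normal_pdf2 (a s y : R) : s != 0 ->
  measurable_fun setT
    (fun z : R * R => normal_pdf (a + y * z.1) s z.2).
Proof.
move=> s0.
have -> : (fun z : R * R => normal_pdf (a + y * z.1) s z.2) =
    (fun z => normal_pdf 0 s (z.2 - (a + y * z.1))).
  by apply/funext => z; rewrite !normal_pdfE// /normal_fun subr0.
apply: measurableT_comp; first exact: measurable_normal_pdf.
apply: measurable_funB; first exact: measurable_snd.
apply: measurable_funD => //; apply: measurable_funM => //.
Qed.

(** After Tonelli the integral over [t] is that of the conditional density of t given u, whose total
    mass is 1; what remains is the marginal law of u, with the variances added. *)
Lemma normal_prob_mix (a s y : R) (B : set R) : s != 0 -> measurable B ->
  measurable_fun setT (fun t : R => normal_prob (a + y * t) s B) /\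
  (\int[normal_prob 0 1]_t normal_prob (a + y * t) s B =
    normal_prob a (Num.sqrt (s ^+ 2 + y ^+ 2)) B)%E.
Proof.
move=> s0 mB; set w := Num.sqrt _.
pose f (z : R * R) := (normal_pdf (a + y * z.1) s z.2 * \1_B z.2)%:E.
have mf : measurable_fun setT f.
  apply/measurable_EFinP; apply: measurable_funM.
    exact: measurable_normal_pdf2.
  by apply: measurableT_comp => //; exact: measurable_indic.
have f0 z : (0 <= f z)%E by rewrite lee_fin mulr_ge0 ?normal_pdf_ge0.
have fE t : normal_prob (a + y * t) s B = (\int[mu]_u f (t, u))%E.
  rewrite /normal_prob integral_mkcond; apply: eq_integral => u _.
  by rewrite epatch_indic /f /= EFinM.
have mF : measurable_fun setT (fun t : R => normal_prob (a + y * t) s B).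
  rewrite (_ : (fun _ => _) = fubini_F mu f); last by apply/funext.
  exact: measurable_fun_fubini_tonelli_F.
split=> //; rewrite ge0_integral_normal_prob//.
pose h (z : R * R) := (normal_pdf a w z.2 * \1_B z.2 *
  normal_pdf (y * (z.2 - a) / w ^+ 2) (s / w) z.1)%:E.
have hE z : h z = (f z * (normal_pdf 0 1 z.1)%:E)%E.
  have e := normal_pdf_mul a y z.1 z.2 s0.
  by rewrite /h /f -EFinM; congr EFin; rewrite mulrAC -e mulrAC.
have mh : measurable_fun setT h.
  rewrite (_ : h = (fun z => f z * (normal_pdf 0 1 z.1)%:E)%E); last first.
    by apply/funext => z; exact: hE.
  apply: emeasurable_funM => //; apply/measurable_EFinP.
  by apply: measurableT_comp; [exact: measurable_normal_pdf|exact: measurable_fst].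
have h0 z : (0 <= h z)%E by rewrite lee_fin !mulr_ge0 ?normal_pdf_ge0.
transitivity (\int[mu]_t \int[mu]_u h (t, u))%E.
  apply: eq_integral => t _; rewrite fE -ge0_integralZr//.
  - by apply: eq_integral => u _; rewrite hE.
  - exact: measurableT_comp mf (measurable_pair1 t).
  - by rewrite lee_fin normal_pdf_ge0.
rewrite fubini_tonelli// /normal_prob [RHS]integral_mkcond.
apply: eq_integral => u _; rewrite epatch_indic /h /=.
under eq_integral do rewrite EFinM.
rewrite ge0_integralZl//.
- by rewrite integral_normal_pdf mule1 EFinM.
- by apply/measurable_EFinP; exact: measurable_normal_pdf.
- by move=> t _; rewrite lee_fin normal_pdf_ge0.
- by rewrite lee_fin mulr_ge0 ?normal_pdf_ge0.

Qed.

End NormalConvolution.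

(** * Linear forms in the entries of a row *)

Section Rows.
Variables (R : realType) (K : finType).
Local Notation V := (vecspace R K).
Variables lo hi : R.
Hypothesis lohi : lo <= hi.

(* The mass N(c, s2) gives to [[lo, hi]]. The Dirac case s2 = 0 is included so that
   a linear form in Gaussian entries can be integrated one entry at a time. *)
Definition slab_mass (s2 c : R) : \bar R :=
  if s2 == 0 then (\1_`[lo, hi] c)%:E else normal_prob c (Num.sqrt s2) `[lo, hi].

Lemma slab_mass_ge0 s2 c : (0 <= slab_mass s2 c)%E.
Proof. by rewrite /slab_mass; case: ifP => // _; rewrite lee_fin. Qed.

(** A further entry of weight [y] adds [y ^+ 2] to the variance. Starting from variance 0, the law
    stays a point mass if y = 0 and becomes the image of N(0, 1) under an affine map otherwise. *)
Lemma slab_mass_step (s2 c y : R) : 0 <= s2 ->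
  measurable_fun setT (fun t : R => slab_mass s2 (c + y * t)) /\
  (\int[normal_prob 0 1]_t slab_mass s2 (c + y * t) = slab_mass (s2 + y ^+ 2) c)%E.
Proof.
rewrite le_eqVlt eq_sym => /orP[/eqP ->|s20]; last first.
  have s0 : Num.sqrt s2 != 0 by rewrite gt_eqF// sqrtr_gt0.
  have sy : s2 + y ^+ 2 != 0 by rewrite gt_eqF// ltr_wpDr ?sqr_ge0.
  rewrite /slab_mass (gt_eqF s20) (negbTE sy) -{3}(sqr_sqrtr (ltW s20)).
  exact: normal_prob_mix.
rewrite /slab_mass add0r eqxx sqrf_eq0.
have [-> | y0] := eqVneq y 0.
  split.
    rewrite (_ : (fun _ => _) = cst (\1_`[lo, hi] c)%:E); last first.
      by apply/funext => t; rewrite mul0r addr0.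
    exact: measurable_cst.
  under eq_integral do rewrite mul0r addr0.
  by rewrite integral_cst// [X in (_ * X)%E]probability_setT mule1.
have mS : measurable [set t | lo <= c + y * t <= hi].
  rewrite (_ : [set t | _] = setT `&` (fun t => c + y * t) @^-1` `[lo, hi]).
    have mf : measurable_fun setT (fun t : R => c + y * t).
      by apply: measurable_funD => //; exact: measurable_funM.
    exact: mf.
  by rewrite setTI; apply/seteqP; split => t /=; rewrite in_itv.
have fE : (fun t : R => (\1_`[lo, hi] (c + y * t))%:E) =
    (fun t => (\1_[set t | lo <= c + y * t <= hi] t : R)%:E).
  by apply/funext => t; rewrite !indicE; congr (_%:R%:E); apply/idP/idP;
    rewrite !inE/= in_itv.
split; first by rewrite fE; apply/measurable_EFinP; exact: measurable_indic.
under eq_integral do rewrite -/((fun t : R => (\1_`[lo, hi] (c + y * t))%:E) _).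
rewrite fE integral_indic// setIT sqrtr_sqr.
exact: normal_prob_affine.
Qed.

(** The terms already drawn are absorbed into the centre [c], while the weights still to be drawn
    make up the variance. *)
Lemma iter_resample_row (g : V -> \bar R) (q : R) (y : K -> R) (ks : seq K) :
  (forall v, 0 <= g v)%E -> measurable_fun setT g -> 0 <= q -> uniq ks ->
  forall v c,
  (forall v' : V, agree_off ks v v' ->
    lo <= c + \sum_(k <- ks) y k * v' k <= hi -> (q%:E <= g v')%E) ->
  (q%:E * slab_mass (\sum_(k <- ks) y k ^+ 2) c <= iter_resample ks g v)%E.
Proof.
move=> g0 mg q0; elim: ks => [_ v c h|k ks IH /= /andP[kks uks] v c h].
  rewrite big_nil /slab_mass eqxx -EFinM indicE mem_setE in_itv/=.
  have [cI|_] := boolP (lo <= c <= hi); last by rewrite mulr0.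
  by rewrite mulr1; apply: h => //; rewrite big_nil addr0.
rewrite big_cons addrC.
set s2 := \sum_(j <- ks) _.
have s20 : 0 <= s2 by rewrite sumr_ge0// => j _; rewrite sqr_ge0.
have [ms <-] := slab_mass_step c (y k) s20.
rewrite -ge0_integralZl//; last by move=> t _; exact: slab_mass_ge0.
apply: ge0_le_integral => //.
- by move=> t _; rewrite mule_ge0 ?slab_mass_ge0.
- exact: emeasurable_funM.
- by apply: measurable_section_upd; exact: measurable_iter_resample.
move=> t _; apply: IH => // v' agr vI.
have v'k : v' k = t by rewrite agr// /upd eqxx.
apply: h => [i|].
  rewrite inE negb_or => /andP[ik iks].
  by rewrite agr// /upd (negbTE ik).
by rewrite big_cons v'k addrA.
Qed.

End Rows.

Section RowBlock.
Variables (R : realType) (m n : nat).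
Local Notation K := ('I_m * 'I_n)%type.
Local Notation V := (vecspace R K).

Definition row_keys (rs : seq 'I_m) : seq K :=
  [seq (i, j) | i <- rs, j <- enum 'I_n].

Lemma mem_row_keys rs k : (k \in row_keys rs) = (k.1 \in rs).
Proof.
case: k => i j; apply/allpairsP/idP => [[[i' j'] /= [i'rs _ [-> _]]]//|ii].
by exists (i, j); rewrite mem_enum.
Qed.

(** The vector [y] is fixed before these rows are drawn, so each row contributes a factor [q]
    whatever the other rows are. *)
Lemma iter_resample_rows (lo hi : R) (g : V -> \bar R) (q : R) (y : 'I_n -> R)
    (c : 'I_m -> R) (rs : seq 'I_m) :
  lo <= hi -> (forall v, 0 <= g v)%E -> measurable_fun setT g -> 0 <= q ->
  uniq rs ->
  (forall i, i \in rs -> (q%:E <= slab_mass lo hi (\sum_j y j ^+ 2) (c i))%E) ->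
  forall v,
  (forall v' : V, agree_off (row_keys rs) v v' ->
    (forall i, i \in rs -> lo <= c i + \sum_j y j * v' (i, j) <= hi) ->
    (1 <= g v')%E) ->
  ((q ^+ size rs)%:E <= iter_resample (row_keys rs) g v)%E.
Proof.
move=> lohi g0 mg q0; elim: rs => [_ _ v|i rs IH /= /andP[iis uis] qs v h].
  by apply.
rewrite iter_resample_cat.
set ki := [seq (i, j) | j <- enum 'I_n].
have step : ((q ^+ size rs)%:E * slab_mass lo hi (\sum_(k <- ki) y k.2 ^+ 2) (c i) <=
    iter_resample ki (iter_resample (row_keys rs) g) v)%E.
  apply: iter_resample_row => //.
  - exact: iter_resample_ge0.
  - exact: measurable_iter_resample.
  - exact: exprn_ge0.
  - by rewrite map_inj_uniq ?enum_uniq// => ? ? [].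
  move=> v' agr vI; apply: IH => // [j jis|v'' agr' vI'].
    by apply: qs; rewrite inE jis orbT.
  apply: h => [k kis|j].
    have [k1 k2] : k \notin row_keys rs /\ k \notin ki.
      rewrite -[row_keys _]/(ki ++ row_keys rs) mem_cat negb_or in kis.
      by case/andP: kis.
    by rewrite agr'// agr.
  rewrite inE => /orP[/eqP ->|]; last exact: vI'.
  move: vI; rewrite big_map big_enum /=.
  under eq_bigr => j1 _ do rewrite -agr' ?mem_row_keys//.
  by [].
apply: le_trans step; rewrite exprSr EFinM lee_wpmul2l ?lee_fin ?exprn_ge0//.
by rewrite big_map big_enum; apply: qs; rewrite inE eqxx.
Qed.

End RowBlock.

(** * Measurability of the success event *)

Section MatrixSets.
Variables (R : realType) (m n : nat).
Local Notation V := (vecspace R ('I_m * 'I_n)%type).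

Definition mx_of (v : 'I_m * 'I_n -> R) : 'M[R]_(m, n) :=
  \matrix_(i, j) v (i, j).

(** An open set of matrices is the countable union of the cubes with rational centre and radius 1 /
    (k + 1) that it contains, and each cube is a finite intersection of conditions on single
    entries. *)
Lemma measurable_open_mx (U : set 'M[R]_(m, n)) :
  open U -> measurable ([set v | U (mx_of v)] : set V).
Proof.
move=> oU.
pose B (z : 'M[rat]_(m, n) * nat) : set 'M[R]_(m, n) :=
  [set M | forall i j, `|M i j - ratr (z.1 i j)| < z.2.+1%:R^-1].
pose F z : set V := if `[< B z `<=` U >] then [set v | B z (mx_of v)] else set0.
rewrite (_ : [set v | _] = \bigcup_z F z); last first.
  apply/seteqP; split => v /=; last first.
    by move=> [z _]; rewrite /F; case: asboolP => // BU /BU.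
  move=> Uv; have /nbhs_ballP[e /= e0 eU] : nbhs (mx_of v) U.
    by move: oU; rewrite openE; apply.
  have [k ke] : exists k : nat, k.+1%:R^-1 < e / 2.
    have := @near_infty_natSinv_lt R (PosNum (divr_gt0 e0 (@ltr0n R 2))).
    by move=> /filter_ex[k /= hk]; exists k.
  have ex (x : R) : exists r : rat, `|x - ratr r| < k.+1%:R^-1.
    have k0 : (0 : R) < k.+1%:R^-1 by rewrite invr_gt0.
    have [|r] := @rat_in_itvoo R (x - k.+1%:R^-1) (x + k.+1%:R^-1).
      by rewrite ltrBlDr -addrA ltrDl addr_gt0.
    by rewrite in_itv/= => /andP[h1 h2]; exists r; rewrite ltr_distlC h1.
  have [Q QP] := choice ex.
  exists ((\matrix_(i, j) Q (v (i, j)) : 'M[rat]_(m, n)), k) => //.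
  rewrite /F; case: asboolP => [_|] /=; first by move=> i j /=; rewrite !mxE.
  case=> M BM; apply: eU; split=> // i j; rewrite /ball/=.
  have := BM i j; have := QP (v (i, j)); rewrite !mxE /=.
  move=> h1 h2; apply: le_lt_trans (ler_distD (ratr (Q (v (i, j)))) _ _) _.
  rewrite [ltRHS](splitr e) ltrD ?(lt_trans h1)//.
  by rewrite distrC (lt_trans h2).
apply: countable_bigcupT_measurable; first exact: countableP.
move=> z; rewrite /F; case: asboolP => _ //.
rewrite (_ : [set v | _] = \bigcap_(k in [set: 'I_m * 'I_n])
  ((fun v : V => v k) @^-1` [set x | `|x - ratr (z.1 k.1 k.2)| < z.2.+1%:R^-1])).
  apply: fin_bigcap_measurable => // k _; rewrite -[_ @^-1` _]setTI.
  apply: measurable_coord => //.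
  rewrite (_ : [set x | _] = `]ratr (z.1 k.1 k.2) - z.2.+1%:R^-1,
      ratr (z.1 k.1 k.2) + z.2.+1%:R^-1[%classic) //.
  by apply/seteqP; split => x; rewrite /= in_itv/= ltr_distl.
apply/seteqP; split => v /=.
  by move=> Bv [i j] _; have := Bv i j; rewrite mxE.
by move=> h i j; rewrite mxE; exact: (h (i, j)).
Qed.

Lemma continuous_entries (T : topologicalType) p q (f : T -> 'M[R]_(p, q)) :
  (forall i j, continuous (fun x => f x i j)) -> continuous f.
Proof.
move=> cf x A [P Pn PA].
have : \forall y \near x, forall k : 'I_p * 'I_q, P k.1 k.2 (f y k.1 k.2).
  by apply: filter_forall => k; exact: (cf _ _ x _ (Pn k.1 k.2)).
by apply: filterS => y h; apply: PA => i j; exact: (h (i, j)).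
Qed.

Lemma continuous_mulmx_affine (p : 'cV[R]_m) :
  continuous (fun z : 'M[R]_(m, n) * 'rV[R]_n => z.1 *m z.2^T + p).
Proof.
apply: continuous_entries => i j.
rewrite (_ : (fun _ => _) =
  (fun z : 'M[R]_(m, n) * 'rV[R]_n => \sum_k z.1 i k * z.2 ord0 k + p i j)).
  move=> z; apply: cvgD; last exact: cvg_cst.
  apply: cvg_big => [|k _]; first exact: add_continuous.
  apply: cvgM.
    apply: (@continuous_comp _ _ _ fst (fun M : 'M[R]_(m, n) => M i k)).
      exact: cvg_fst.
    exact: coord_continuous.
  apply: (@continuous_comp _ _ _ snd (fun y : 'rV[R]_n => y ord0 k)).
    exact: cvg_snd.
  exact: coord_continuous.
apply/funext => z; rewrite !mxE; congr (_ + _).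
by apply: eq_bigr => k _; rewrite mxE (ord1 j).
Qed.

(** The projection along [y] of a closed set need not be closed. Restricted to [y] in a compact cube
    it is closed, and countably many cubes cover the space. *)
Lemma measurable_mx_meets (C : set 'cV[R]_m) (p : 'cV[R]_m) : closed C ->
  measurable ([set v | exists y, C (mx_of v *m y + p)] : set V).
Proof.
move=> cC.
pose Q (r : nat) := [set y : 'rV[R]_n | forall i, `[- r%:R, r%:R]%classic (y ord0 i)].
have cQ r : compact (Q r).
  exact: (@rV_compact R n (fun=> `[- r%:R, r%:R]%classic)
    (fun=> @segment_compact R _ _)).
pose N r := [set M : 'M[R]_(m, n) | forall y, Q r y -> ~ C (M *m y^T + p)].
have oN r : open (N r).
  rewrite openE => M NM; rewrite /interior.
  (* The tube lemma: each [y] in the cube avoids [C] for all matrices near [M], and compactness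
     makes the neighbourhood of [M] uniform in [y]. *)
  have := (compact_near_coveringP (Q r)).1 (cQ r) _ (nbhs M)
    (fun M' y => ~ C (M' *m y^T + p)) _.
  apply => y Qy.
  have : \forall z \near (M, y), ~ C (z.1 *m z.2^T + p).
    apply: (@continuous_mulmx_affine p (M, y) (~` C)).
    by apply: open_nbhs_nbhs; split; [exact: closed_openC|exact: NM].
  move=> [[A B] /= [AM By] AB]; exists (B, A) => //= -[y' M'] [/= By' AM'].
  exact: (AB (M', y')).
rewrite (_ : [set v | _] = \bigcup_r ~` [set v : V | N r (mx_of v)]).
  by apply: bigcupT_measurable => r; apply: measurableC; exact: measurable_open_mx.
apply/seteqP; split => v /=.
  move=> [y Cy].
  pose r := Num.truncn (\sum_i `|y i ord0|).
  exists r.+1 => // Nv; apply: (Nv y^T); last by rewrite trmxK.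
  move=> i /=; rewrite mxE in_itv/= -ler_norml.
  apply: (@le_trans _ _ (\sum_i `|y i ord0|)); last exact/ltW/truncnS_gt.
  by rewrite (bigD1 i)//= lerDl sumr_ge0.
move=> [r _ /existsNP[y /not_implyP[_ /contrapT Cy]]].
by exists y^T.
Qed.

End MatrixSets.

(** * Short solutions of the top block *)

Section LeastNorm.
Variables (R : realFieldType) (n d : nat).
Implicit Types (B : 'M[R]_(n, d)) (a u : 'I_n -> R).

Lemma sqr_sum_le (I : finType) (P : pred I) (x : I -> R) :
  (\sum_(i | P i) x i) ^+ 2 <= #|I|%:R * \sum_(i | P i) x i ^+ 2.
Proof.
rewrite expr2 mulr_suml.
apply: (@le_trans _ _ (\sum_(i | P i) \sum_(j | P j) (x i ^+ 2 + x j ^+ 2) / 2)).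
  apply: ler_sum => i _; rewrite mulr_sumr; apply: ler_sum => j _.
  by have := sqr_ge0 (x i - x j); rewrite sqrrB; lra.
set Q := \sum_(i | P i) x i ^+ 2.
have Q0 : 0 <= Q by apply: sumr_ge0 => i _; exact: sqr_ge0.
have e1 : \sum_(i | P i) \sum_(j | P j) x i ^+ 2 = #|P|%:R * Q.
  under eq_bigr => i _ do rewrite sumr_const.
  by rewrite sumrMnl mulr_natl.
have -> : \sum_(i | P i) \sum_(j | P j) (x i ^+ 2 + x j ^+ 2) / 2 =
    (#|P|%:R * Q + #|P|%:R * Q) / 2.
  rewrite -{1}e1 -e1 [X in (_ + X) / _]exchange_big -big_split/= mulr_suml.
  by apply: eq_bigr => i _; rewrite -big_split/= mulr_suml.
rewrite mulrDl -splitr ler_wpM2r// ler_nat.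
exact: max_card.
Qed.

(* The rows are B i = a i * b + N i, b the pivot row, so that the sum
   is |t b + sum u_i N_i|^2; it is bounded below because the N i are almost
   orthogonal to b and almost orthonormal in the columns s k. *)
Lemma gram_lower_bound B a (i0 : 'I_n) (s : 'I_n -> 'I_d) (x eta : R) u :
  injective s -> a i0 = 1 -> 0 <= eta -> n%:R * eta <= 2^-1 ->
  x ^+ 2 + 4 * n%:R <= \sum_j B i0 j ^+ 2 ->
  (forall i, i != i0 ->
    `|\sum_j (B i j - a i * B i0 j) * B i0 j| <= 1) ->
  (forall i k, i != i0 -> k != i0 ->
    `|B i (s k) - a i * B i0 (s k) - (i == k)%:R| <= eta) ->
  forall t, t = \sum_i u i * a i ->
  x ^+ 2 * t ^+ 2 + 4 * t ^+ 2 +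
    \sum_(i | i != i0) (`|u i| / 2 - 2 * `|t|) ^+ 2 <=
  \sum_j (\sum_i u i * B i j) ^+ 2.
Proof.
move=> injs a1 eta0 neta hb hdot hdiag t tE.
pose N i j := B i j - a i * B i0 j.
pose w j := \sum_(i | i != i0) u i * N i j.
have split_row j : \sum_i u i * B i j = t * B i0 j + w j.
  rewrite tE /w mulr_suml [X in _ = X + _](bigD1 i0)//= (bigD1 i0)//= a1 mulr1.
  rewrite -addrA -big_split/=; congr (_ + _); apply: eq_bigr => i _.
  by rewrite /N; ring.
have -> : \sum_j (\sum_i u i * B i j) ^+ 2 =
    t ^+ 2 * (\sum_j B i0 j ^+ 2) + 2 * t * (\sum_j w j * B i0 j) +
    \sum_j w j ^+ 2.
  rewrite !mulr_sumr -!big_split/=; apply: eq_bigr => j _.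
  by rewrite split_row; ring.
set U := \sum_(i | i != i0) u i ^+ 2.
set S := \sum_(i | i != i0) `|u i|.
have U0 : 0 <= U by apply: sumr_ge0 => i _; exact: sqr_ge0.
have S0 : 0 <= S by apply: sumr_ge0.
have cross : - (`|t| * S) <= t * (\sum_j w j * B i0 j).
  rewrite lerNl -mulrN; apply: le_trans (ler_norm _) _.
  rewrite normrM normrN ler_wpM2l//.
  rewrite /w (eq_bigr (fun j => \sum_(i | i != i0) u i * (N i j * B i0 j))); last first.
    by move=> j _; rewrite mulr_suml; apply: eq_bigr => i _; rewrite mulrA.
  rewrite exchange_big/=; apply: le_trans (ler_norm_sum _ _ _) _.
  apply: ler_sum => i ii0; rewrite -mulr_sumr normrM ler_piMr//.
  exact: hdot.
(* Only the columns [s k] are kept. There [w (s k)] is [u k + e] with |e| <= eta * S, and (u + e)^2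
   >= u^2 / 2 - e^2. As S^2 <= n U and n eta <= 1 / 2, the errors add up to at most U / 4. *)
have wlow : U / 4 <= \sum_j w j ^+ 2.
  have inj_sum : \sum_(k | k != i0) w (s k) ^+ 2 <= \sum_j w j ^+ 2.
    pose A : {set 'I_n} := [set~ i0]%SET.
    have -> : \sum_(k | k != i0) w (s k) ^+ 2 = \sum_(k in A) w (s k) ^+ 2.
      by apply: eq_bigl => k; rewrite in_setC1.
    rewrite [leRHS](bigID (fun j => j \in s @: A)%SET)/=.
    rewrite (big_imset (fun j => w j ^+ 2)) /=; last by move=> ? ? _ _; exact: injs.
    by rewrite lerDl sumr_ge0// => j _; exact: sqr_ge0.
  apply: le_trans inj_sum.
  have err k : k != i0 -> u k ^+ 2 / 2 - (eta * S) ^+ 2 <= w (s k) ^+ 2.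
    move=> ki0; set e := w (s k) - u k.
    have eS : e ^+ 2 <= (eta * S) ^+ 2.
      rewrite -(real_normK (num_real e)) lerXn2r ?nnegrE ?mulr_ge0//.
      have -> : e = \sum_(i | i != i0) u i * (N i (s k) - (i == k)%:R).
        rewrite /e /w; under [RHS]eq_bigr => i _ do rewrite mulrBr.
        rewrite sumrB; congr (_ - _).
        rewrite (bigD1 k)//= eqxx mulr1 big1 ?addr0// => i /andP[_ /negbTE ->].
        by rewrite mulr0.
      rewrite mulr_sumr; apply: le_trans (ler_norm_sum _ _ _) _.
      apply: ler_sum => i ii0; rewrite normrM mulrC ler_wpM2r//.
      exact: hdiag.
    have -> : w (s k) = u k + e by rewrite /e addrC subrK.
    have -> : (u k + e) ^+ 2 = u k ^+ 2 / 2 - e ^+ 2 + (u k + 2 * e) ^+ 2 / 2 by field.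
    by rewrite ler_wpDr ?divr_ge0 ?sqr_ge0// lerD2l lerN2.
  apply: le_trans (ler_sum _ err); rewrite sumrB -mulr_suml -/U sumr_const.
  have SU : S ^+ 2 <= n%:R * U.
    have := @sqr_sum_le _ (fun i => i != i0) (fun i => `|u i|).
    rewrite card_ord -/S => /le_trans; apply; rewrite ler_wpM2l//.
    by apply: ler_sum => i _; rewrite real_normK ?num_real.
  have cn : #|[pred i : 'I_n | i != i0]|%:R <= n%:R :> R.
    by rewrite ler_nat -[leqRHS]card_ord max_card.
  have ne0 : 0 <= n%:R * eta by rewrite mulr_ge0.
  have e1 : (eta * S) ^+ 2 *+ #|[pred i : 'I_n | i != i0]| <= (n%:R * eta) ^+ 2 * U.
    rewrite -mulr_natl [leRHS](_ : _ = n%:R * (eta ^+ 2 * (n%:R * U))); last by ring.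
    by rewrite ler_pM// ?mulr_ge0 ?sqr_ge0// exprMn ler_wpM2l ?sqr_ge0.
  have e2 : (n%:R * eta) ^+ 2 * U <= (2^-1) ^+ 2 * U.
    by rewrite ler_wpM2r// lerXn2r ?nnegrE.
  have : (2^-1 : R) ^+ 2 = 4^-1 by field.
  move=> e3; apply: (@le_trans _ _ (U / 2 - (2^-1) ^+ 2 * U)).
    by rewrite e3; lra.
  by rewrite lerD2l lerN2; exact: le_trans e1 e2.
(* Completing these squares takes 4 t^2 for each nonpivot row, which is why the pivot row is given
   the surplus 4 n over x^2. *)
have -> : \sum_(i | i != i0) (`|u i| / 2 - 2 * `|t|) ^+ 2 =
    U / 4 - 2 * `|t| * S + 4 * t ^+ 2 *+ (#|[pred i : 'I_n | i != i0]|).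
  rewrite /U /S mulr_suml mulr_sumr -sumrB -sumr_const -big_split/=.
  apply: eq_bigr => i _.
  by rewrite -(real_normK (num_real t)) -(real_normK (num_real (u i))); field.
have cardE : #|[pred i : 'I_n | i != i0]| = n.-1.
  by rewrite cardC1 card_ord.
rewrite cardE.
have n1 : n.-1%:R + 1 = n%:R :> R by rewrite natr1 prednK// (leq_ltn_trans _ (ltn_ord i0)).
have hb' := ler_wpM2l (sqr_ge0 t) hb.
rewrite -n1 in hb'; rewrite -mulr_natl.
by move: (n.-1%:R : R) hb' cross wlow => c; nra.
Qed.

(* The hypothesis says that |a . u| <= |B^T u| / x; by duality this bounds the
   least-norm solution B^T (B B^T)^-1 (2 a). *)
Lemma exists_small_preimage B a (x : R) : 0 < x ->
  (forall u,
    x ^+ 2 * (\sum_i u i * a i) ^+ 2 <= \sum_j (\sum_i u i * B i j) ^+ 2) ->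
  (forall u, \sum_j (\sum_i u i * B i j) ^+ 2 = 0 -> forall i, u i = 0) ->
  exists y : 'cV[R]_d,
    (forall i, (B *m y) i ord0 = 2 * a i) /\ \sum_j y j ord0 ^+ 2 <= (2 / x) ^+ 2.
Proof.
move=> x0 low nondeg.
pose G := B *m B^T.
(* A row vector r with r G = 0 satisfies |r B|^2 = 0, hence vanishes by [nondeg]. *)
have Gu : G \in unitmx.
  rewrite -row_free_unit -kermx_eq0; apply/eqP/row_matrixP => i; rewrite row0.
  set r := row i (kermx G).
  have rG : r *m G = 0.
    by apply/sub_kermxP; exact: row_sub.
  apply/rowP => k; rewrite [RHS]mxE.
  apply: (nondeg (fun k => r ord0 k)).
  have : (r *m B) *m (r *m B)^T = 0 by rewrite trmx_mul mulmxA -(mulmxA r) rG mul0mx.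
  move=> /matrixP /(_ ord0 ord0); rewrite !mxE => h; rewrite -[RHS]h.
  by apply: eq_bigr => j _; rewrite !mxE expr2.
pose z : 'cV[R]_n := \col_i (2 * a i).
pose u := invmx G *m z.
pose y := B^T *m u.
have By : B *m y = z by rewrite /y /u !mulmxA mulmxV// mul1mx.
exists y; split; first by move=> i; rewrite By mxE.
pose t := \sum_i u i ord0 * a i.
have yE : \sum_j (\sum_i u i ord0 * B i j) ^+ 2 = \sum_j y j ord0 ^+ 2.
  apply: eq_bigr => j _; rewrite !mxE; congr (_ ^+ 2).
  by apply: eq_bigr => i _; rewrite !mxE mulrC.
have y2 : \sum_j y j ord0 ^+ 2 = 2 * t.
  have : y^T *m y = u^T *m z by rewrite {1}/y trmx_mul trmxK -mulmxA By.
  move=> /matrixP /(_ ord0 ord0); rewrite !mxE.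
  rewrite (eq_bigr (fun j => y j ord0 ^+ 2)); last by move=> j _; rewrite mxE expr2.
  by move=> ->; rewrite /t mulr_sumr; apply: eq_bigr => i _; rewrite !mxE mulrCA.
have := low (fun i => u i ord0); rewrite yE -/t => lt.
have x2 : 0 < x ^+ 2 by rewrite exprn_gt0.
rewrite y2 expr_div_n ler_pdivlMr//.
rewrite y2 in lt.
(* Here |y|^2 = 2 t and x^2 t^2 <= |y|^2, so that t <= 2 / x^2 as soon as t > 0. *)
have [t0|t0] := leP t 0.
  by rewrite (@le_trans _ _ 0)// ?exprn_ge0// pmulr_lle0// pmulr_rle0.
have h : x ^+ 2 * t <= 2 by rewrite -(ler_pM2r t0) -mulrA -expr2.
by rewrite mulrAC -mulrA expr2 ler_wpM2l.
Qed.

End LeastNorm.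

(** * Norms and inner products of rows drawn in the intervals *)

Section BoxRows.
Variables (R : realFieldType) (d : nat) (c0 : 'I_d) (T eta : R).
Hypotheses (T2 : 2 <= T) (eta0 : 0 <= eta) (deta : d%:R * eta <= 2^-1).
Implicit Types (b w : 'I_d -> R).

Let d1 : (1 : R) <= d%:R.
Proof. by rewrite ler1n (leq_ltn_trans _ (ltn_ord c0)). Qed.

Let eta2 : eta <= 2^-1.
Proof. by apply: le_trans deta; rewrite ler_peMl. Qed.

Let sum_off_le (F : 'I_d -> R) (C : R) : 0 <= C ->
  (forall j, j != c0 -> F j <= C) -> \sum_(j | j != c0) F j <= d%:R * C.
Proof.
move=> C0 FC; apply: le_trans (ler_sum _ FC) _.
by rewrite sumr_const -[leLHS]mulr_natl ler_wpM2r// ler_nat -[leqRHS]card_ord max_card.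
Qed.

Lemma pivot_row_tail b :
  (forall j, j != c0 -> 0 <= b j <= eta * T) ->
  \sum_(j | j != c0) b j ^+ 2 <= T ^+ 2 / 4.
Proof.
move=> bj; have T0 : 0 < T by apply: lt_le_trans T2.
apply: le_trans (sum_off_le (C := (eta * T) ^+ 2) _ _) _.
- exact: sqr_ge0.
- by move=> j /bj/andP[? ?]; rewrite lerXn2r ?nnegrE ?mulr_ge0 ?(ltW T0).
rewrite exprMn mulrA [eta ^+ 2]expr2 mulrA.
rewrite mulrC ler_wpM2l ?sqr_ge0//.
apply: (@le_trans _ _ (2^-1 * 2^-1)); first by rewrite ler_pM// ?mulr_ge0.
by rewrite -invfM -natrM.
Qed.

(** The last entry brings the squared norm up to T^2. Its interval has length 1 / T and starts at h
    <= T, so the overshoot is at most 2 h / T + 1 / T^2 <= 3. *)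
Lemma pivot_row b h :
  (forall j, j != c0 -> 0 <= b j <= eta * T) ->
  0 <= h -> h ^+ 2 = T ^+ 2 - \sum_(j | j != c0) b j ^+ 2 ->
  h <= b c0 <= h + T^-1 ->
  [/\ T / 2 <= b c0, b c0 <= 2 * T, T ^+ 2 <= \sum_j b j ^+ 2 &
      \sum_j b j ^+ 2 <= T ^+ 2 + 3].
Proof.
have T2' := T2; move=> bj h0; have := pivot_row_tail bj; set Q := \sum_(j | _) _ => QT hE hb.
have T0 : 0 < T by apply: lt_le_trans T2.
have Q0 : 0 <= Q by apply: sumr_ge0 => j _; exact: sqr_ge0.
have hT : h <= T by rewrite -(@ler_pXn2r _ 2) ?nnegrE ?(ltW T0)// hE; lra.
have Th : T / 2 <= h.
  by rewrite -(@ler_pXn2r _ 2) ?nnegrE ?divr_ge0 ?(ltW T0)// hE expr_div_n; nra.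
have iT : T^-1 <= 2^-1 by rewrite lef_pV2 ?posrE.
have TiT : T * T^-1 = 1 by rewrite divff// gt_eqF.
have iT0 : 0 <= T^-1 by rewrite invr_ge0 ltW.
rewrite (bigD1 c0)//= -/Q.
move: hb => /andP[hb1 hb2]; split.
- exact: le_trans hb1.
- by apply: le_trans hb2 (le_trans (lerD hT iT) _); lra.
- have : h ^+ 2 <= b c0 ^+ 2 by rewrite lerXn2r ?nnegrE ?(le_trans h0).
  by rewrite hE; lra.
- have : b c0 ^+ 2 <= (h + T^-1) ^+ 2.
    by rewrite lerXn2r ?nnegrE ?addr_ge0// (le_trans h0).
  have : h * T^-1 <= 1 by rewrite -TiT ler_wpM2r.
  have : T^-1 ^+ 2 <= 1 by rewrite expr_le1// (le_trans iT)// invf_le1// ler1n.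
  by rewrite sqrrD hE mulr2n; lra.
Qed.

(** The pivot entry of [N] nearly cancels the contribution of the other columns to the inner product
    with [b]; the slack eta / T is multiplied by [b c0 <= 2 * T] and costs at most 2 eta <= 1. The
    constant 30 collects 3 from |b|^2, 2 from the cross term and 25 from the pivot entry of [N]. *)
Lemma other_row b w (a : R) (delta : 'I_d -> R) :
  (forall j, j != c0 -> 0 <= b j <= eta * T) ->
  T / 2 <= b c0 -> b c0 <= 2 * T -> \sum_j b j ^+ 2 <= T ^+ 2 + 3 ->
  `|a| <= 1 ->
  let N j := w j - a * b j in
  (forall j, j != c0 -> 0 <= delta j <= 1) ->
  (forall j, j != c0 -> delta j <= N j <= delta j + eta) ->
  let r := (\sum_(j | j != c0) N j * b j) / b c0 in
  - r <= N c0 <= - r + eta / T ->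
  `|\sum_j N j * b j| <= 1 /\
  \sum_j w j ^+ 2 <= T ^+ 2 + 4 * d%:R + 30.
Proof.
have T2' := T2; have eta0' := eta0; have eta2' := eta2; have deta' := deta.
move=> bj bT1 bT2 b2 a1 N dj Nj r.
set S := \sum_(j | j != c0) N j * b j in r *.
move=> /andP[r1 r2].
have T0 : 0 < T by apply: lt_le_trans T2.
have beta0 : 0 < b c0 by apply: lt_le_trans bT1; rewrite divr_gt0.
have N01 j : j != c0 -> 0 <= N j <= 2.
  by move=> jc; have := dj j jc; have := Nj j jc; lra.
have S0 : 0 <= S.
  apply: sumr_ge0 => j jc; have /andP[? _] := N01 j jc; have /andP[? _] := bj j jc.
  exact: mulr_ge0.
have ST : S <= T.
  apply: le_trans (sum_off_le (C := 2 * (eta * T)) _ _) _.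
  - by rewrite !mulr_ge0// ltW.
  - move=> j jc; have /andP[? ?] := N01 j jc; have /andP[? ?] := bj j jc.
    by rewrite ler_pM.
  rewrite !mulrA ler_piMl ?(ltW T0)// mulrAC; lra.
have rb : r * b c0 = S by rewrite /r divfK// gt_eqF.
have eT0 : 0 <= eta / T by rewrite divr_ge0 ?(ltW T0).
have eT : eta / T * b c0 <= 1.
  apply: (@le_trans _ _ (eta / T * (2 * T))); first by rewrite ler_wpM2l.
  by rewrite mulrCA divfK ?gt_eqF//; lra.
have sumN : \sum_j N j * b j = N c0 * b c0 + S by rewrite (bigD1 c0).
have dot0 : 0 <= \sum_j N j * b j.
  rewrite sumN -rb -mulrDl mulr_ge0 ?(ltW beta0)//; lra.
have dot1 : \sum_j N j * b j <= 1.
  apply: le_trans eT; rewrite sumN -rb -mulrDl ler_wpM2r ?(ltW beta0)//; lra.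
have r02 : 0 <= r <= 2.
  rewrite /r divr_ge0 ?(ltW beta0)//= ler_pdivrMr//; lra.
have Nc : N c0 ^+ 2 <= 25.
  have eT1 : eta / T <= 1 by rewrite ler_pdivrMr//; lra.
  have -> : 25 = 5 ^+ 2 :> R by rewrite -natrX.
  rewrite -(real_normK (num_real (N c0))) lerXn2r ?nnegrE//.
  by rewrite ler_norml; apply/andP; split; lra.
have N2 : \sum_j N j ^+ 2 <= 4 * d%:R + 25.
  rewrite (bigD1 c0)//= addrC lerD// mulrC; apply: sum_off_le => // j jc.
  have /andP[? ?] := N01 j jc.
  have -> : 4 = 2 ^+ 2 :> R by rewrite -natrX.
  by rewrite lerXn2r ?nnegrE.
split; first by rewrite ger0_norm.
have -> : \sum_j w j ^+ 2 = a ^+ 2 * (\sum_j b j ^+ 2) +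
    2 * a * (\sum_j N j * b j) + \sum_j N j ^+ 2.
  rewrite !mulr_sumr -!big_split/=; apply: eq_bigr => j _; rewrite /N; ring.
have : a ^+ 2 <= 1 by rewrite -(real_normK (num_real a)) expr_le1.
have B0 : 0 <= \sum_j b j ^+ 2 by apply: sumr_ge0 => j _; exact: sqr_ge0.
move: a1; rewrite ler_norml => /andP[a1 a2] aa.
have : a ^+ 2 * (\sum_j b j ^+ 2) <= \sum_j b j ^+ 2 by rewrite ler_piMl.
have : a * (\sum_j N j * b j) <= 1.
  by apply: le_trans dot1; rewrite ler_piMl.
by lra.
Qed.

End BoxRows.

(** * The intervals for the top block *)

Section GoodBlock.
Variables (R : realType) (D d n : nat) (r0 : 'I_D) (c0 : 'I_d).
Variables (a : 'I_D -> R) (x T eta : R).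
Local Notation K := ('I_D * 'I_d)%type.
Local Notation V := (vecspace R K).
Implicit Types (v : V) (k : K).

(* Order in which the entries of the first n rows are drawn: pivot row first,
   and in each row the pivot entry last. *)
Definition draw_rank k : nat :=
  if k.1 == r0 then (k.2 == c0 : nat) else (k.2 == c0).+2.

(** Entries in the pivot column get a length of order 1 / T, because they enter |b|^2 or an inner
    product with b multiplied by about T. *)
Definition slot_length k : R :=
  if k.1 == r0 then (if k.2 == c0 then T^-1 else eta * T)
  else (if k.2 == c0 then eta / T else eta).

(** The square root completes the pivot row to norm T. Row i otherwise starts at a_i b plus the i-th
    unit vector, except that its pivot entry is shifted so that the deviation from a_i b becomes
    orthogonal to b. *)
Definition slot_start k (v : K -> R) : R :=
  if k.1 == r0 then
    if k.2 == c0 then Num.sqrt (T ^+ 2 - \sum_(j | j != c0) v (r0, j) ^+ 2)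
    else 0
  else if k.2 == c0 then
    a k.1 * v (r0, c0) -
      (\sum_(j | j != c0) (v (k.1, j) - a k.1 * v (r0, j)) * v (r0, j)) /
      v (r0, c0)
  else a k.1 * v (r0, k.2) + (k.1 == k.2 :> nat)%:R.

Definition block_keys : seq K :=
  sort (relpre draw_rank leq) [seq k : K <- enum {: K} | (k.1 < n)%N].

Lemma mem_block_keys k : (k \in block_keys) = (k.1 < n)%N.
Proof. by rewrite mem_sort mem_filter mem_enum andbT. Qed.

Lemma uniq_block_keys : uniq block_keys.
Proof. by rewrite sort_uniq filter_uniq// enum_uniq. Qed.

Lemma pairwise_block_keys :
  pairwise (fun i j => draw_rank i <= draw_rank j)%N block_keys.
Proof.
rewrite -sorted_pairwise; first by apply: sort_sorted => i j; exact: leq_total.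
by move=> j i k; exact: leq_trans.
Qed.

Lemma slot_start_dep k (v v' : K -> R) :
  (forall i, (draw_rank i < draw_rank k)%N -> v i = v' i) ->
  slot_start k v = slot_start k v'.
Proof.
rewrite /slot_start {2}/draw_rank.
case: eqP => [k1|/eqP k1]; case: eqP => [k2|/eqP k2] //= h.
- congr (Num.sqrt (_ - _)); apply: eq_bigr => j jc.
  by rewrite h// /draw_rank eqxx (negbTE jc).
- have h0 j : v (r0, j) = v' (r0, j).
    by apply: h; rewrite /draw_rank eqxx; case: (j == c0).
  congr (_ * _ - _ / _) => //; apply: eq_bigr => j jc.
  by rewrite !h0 h// /draw_rank (negbTE k1) (negbTE jc).
- by rewrite h// /draw_rank eqxx; case: (k.2 == c0).
Qed.

Hypotheses (r0n : (r0 < n)%N) (nD : (n <= D)%N) (nd : (n <= d)%N).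
Hypotheses (rc0 : r0 = c0 :> nat).
Hypotheses (a1 : forall i, `|a i| <= 1) (ar0 : a r0 = 1).
Hypotheses (x0 : 0 < x) (T0 : 0 < T) (T2 : T ^+ 2 = x ^+ 2 + 4 * n%:R).
Hypotheses (eta0 : 0 < eta) (deta : d%:R * eta <= 2^-1).

Let T_ge2 : 2 <= T.
Proof.
rewrite -(@ler_pXn2r _ 2) ?nnegrE ?(ltW T0)// T2.
have n1 : (1 : R) <= n%:R by rewrite ler1n (leq_ltn_trans _ r0n).
have := sqr_ge0 x; rewrite [2 ^+ 2]expr2 -natrM; lra.
Qed.

Section Facts.
Variable v : K -> R.
Hypothesis box : forall k, (k.1 < n)%N ->
  slot_start k v <= v k <= slot_start k v + slot_length k.

Let tail j : j != c0 -> 0 <= v (r0, j) <= eta * T.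
Proof.
move=> jc; have := box (k := (r0, j)) r0n.
by rewrite /slot_start /slot_length /= eqxx (negbTE jc) add0r.
Qed.

Let pivot : [/\ T / 2 <= v (r0, c0), v (r0, c0) <= 2 * T,
  T ^+ 2 <= \sum_j v (r0, j) ^+ 2 & \sum_j v (r0, j) ^+ 2 <= T ^+ 2 + 3].
Proof.
have tl := pivot_row_tail T_ge2 (ltW eta0) deta tail.
apply: (pivot_row T_ge2 (ltW eta0) deta tail (sqrtr_ge0 _)).
  rewrite sqr_sqrtr// subr_ge0; apply: le_trans tl _.
  by rewrite ler_piMr ?sqr_ge0// invf_le1// ler1n.
by have := box (k := (r0, c0)) r0n; rewrite /slot_start /slot_length /= !eqxx.
Qed.

Let other (i : 'I_D) : (i < n)%N -> i != r0 ->
  `|\sum_j (v (i, j) - a i * v (r0, j)) * v (r0, j)| <= 1 /\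
  \sum_j v (i, j) ^+ 2 <= T ^+ 2 + 4 * d%:R + 30.
Proof.
move=> lin ir0; have [p1 p2 p3 p4] := pivot.
apply: (other_row T_ge2 (ltW eta0) deta tail p1 p2 p4 (a1 i)
  (delta := fun j : 'I_d => (i == j :> nat)%:R)).
- by move=> j _; case: (_ == _); rewrite ?lexx ?ler01.
- move=> j jc; have := box (k := (i, j)) lin.
  rewrite /slot_start /slot_length /= (negbTE ir0) (negbTE jc).
  by rewrite -addrA -lerBrDl -[X in _ && X]lerBlDl.
- have := box (k := (i, c0)) lin.
  rewrite /slot_start /slot_length /= (negbTE ir0) eqxx.
  by rewrite -addrA -lerBrDl -[X in _ && X]lerBlDl.
Qed.

Lemma block_sum_sqr :
  \sum_(k <- block_keys) v k ^+ 2 <= n%:R * (T ^+ 2 + 4 * d%:R + 30).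
Proof.
rewrite (perm_big [seq k : K <- enum {: K} | (k.1 < n)%N]) ?perm_sort//=.
rewrite big_filter big_enum_cond /=.
have -> : \sum_(k : K | (k.1 < n)%N) v k ^+ 2 =
    \sum_(i < D | (i < n)%N) \sum_j v (i, j) ^+ 2.
  by rewrite pair_big; apply: eq_big => -[i j] //=; rewrite andbT.
apply: (@le_trans _ _ (\sum_(i < D | (i < n)%N) (T ^+ 2 + 4 * d%:R + 30))).
  apply: ler_sum => i lin; have [->|ir0] := eqVneq i r0; last by case: (other lin ir0).
  have [_ _ _ h] := pivot; apply: (le_trans h).
  by have := ler0n R d; lra.
rewrite -(big_ord_widen _ (fun=> T ^+ 2 + 4 * d%:R + 30) nD) sumr_const card_ord.
by rewrite -[leLHS]mulr_natl.
Qed.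

Lemma block_preimage : exists y : 'I_d -> R,
  (forall i : 'I_D, (i < n)%N -> \sum_j v (i, j) * y j = 2 * a i) /\
  \sum_j y j ^+ 2 <= (2 / x) ^+ 2.
Proof.
pose B : 'M[R]_(n, d) := \matrix_(i, j) v (widen_ord nD i, j).
pose a' (i : 'I_n) := a (widen_ord nD i).
pose i0 := Ordinal r0n.
have wi0 : widen_ord nD i0 = r0 by exact: val_inj.
have wi i : i != i0 -> widen_ord nD i != r0.
  apply: contra => /eqP; rewrite -[r0]wi0 => /(congr1 val) ii.
  exact/eqP/val_inj.
have [_ _ hb _] := pivot.
have low (u : 'I_n -> R) : forall t, t = \sum_i u i * a' i ->
    x ^+ 2 * t ^+ 2 + 4 * t ^+ 2 +
    \sum_(i | i != i0) (`|u i| / 2 - 2 * `|t|) ^+ 2 <=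
    \sum_j (\sum_i u i * B i j) ^+ 2.
  apply: (@gram_lower_bound R n d B a' i0 (widen_ord nd) x eta u).
  - by move=> i j /(congr1 val)/= ij; exact: val_inj.
  - by rewrite /a' wi0.
  - exact: ltW.
  - by apply: le_trans deta; rewrite ler_wpM2r ?(ltW eta0)// ler_nat.
  - by rewrite -T2; under eq_bigr do rewrite mxE wi0.
  - move=> i /wi ii; under eq_bigr do rewrite !mxE wi0.
    by have [] := @other (widen_ord nD i) (ltn_ord i) ii.
  - move=> i k ii ki; rewrite !mxE wi0.
    (* Pivot row and pivot column carry the same index, so nonpivot rows are matched with nonpivot
       columns. *)
    have kc : widen_ord nd k != c0.
      apply: contra ki => /eqP kc; apply/eqP/val_inj => /=.
      by rewrite rc0 -kc.
    have := box (k := (widen_ord nD i, widen_ord nd k)) (ltn_ord i).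
    rewrite /slot_start /slot_length /= (negbTE (wi i ii)) (negbTE kc) -/(a' i).
    have -> : (i == k :> nat) = (i == k) by [].
    rewrite ler_norml => /andP[b1 b2]; apply/andP; split; last by lra.
    by have := ltW eta0; lra.
have [|u|y [By y2]] := @exists_small_preimage R n d B a' x x0.
- move=> u; apply: le_trans (low u _ erefl).
  rewrite -addrA lerDl addr_ge0//; first by rewrite mulr_ge0 ?sqr_ge0.
  by apply: sumr_ge0 => i _; exact: sqr_ge0.
(* If the Gram form vanishes, so do t and the sum of squares. With t = 0 the squares force u i = 0
   off the pivot, and then t reduces to the pivot coordinate of u. *)
- move=> u0.
  have := low u _ erefl; rewrite u0; set t := \sum_i u i * a' i.
  set Q := \sum_(i | _) _ => h.
  have Q0 : 0 <= Q by apply: sumr_ge0 => i _; exact: sqr_ge0.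
  have t2 := sqr_ge0 t.
  have xt : 0 <= x ^+ 2 * t ^+ 2 by rewrite mulr_ge0 ?sqr_ge0.
  have t0 : t = 0.
    by apply/eqP; rewrite -sqrf_eq0; apply/eqP/le_anti/andP; split=> //; lra.
  have Qz : Q = 0 by apply: le_anti; rewrite Q0 andbT; lra.
  have uz i : i != i0 -> u i = 0.
    move=> ii0; move/eqP: Qz; rewrite psumr_eq0; last by move=> k _; exact: sqr_ge0.
    move=> /allP/(_ i (mem_index_enum _)); rewrite ii0 /= t0 normr0 mulr0 subr0.
    by rewrite sqrf_eq0 mulf_eq0 invr_eq0 pnatr_eq0 orbF normr_eq0 => /eqP.
  move=> i; have [->|/uz//] := eqVneq i i0.
  move: t0; rewrite /t (bigD1 i0)//= big1 => [|k /uz ->]; last by rewrite mul0r.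
  by rewrite addr0 /a' wi0 ar0 mulr1.
exists (fun j => y j ord0); split=> // i lin.
rewrite -[i](_ : widen_ord nD (Ordinal lin) = i); last exact: val_inj.
rewrite -By mxE; apply: eq_bigr => j _; by rewrite mxE.
Qed.

End Facts.

Lemma iter_resample_block (g : V -> \bar R) (q : R) :
  (forall v, 0 <= g v)%E -> measurable_fun setT g -> 0 <= q ->
  (forall v, (exists y : 'I_d -> R,
      (forall i : 'I_D, (i < n)%N -> \sum_j v (i, j) * y j = 2 * a i) /\
      \sum_j y j ^+ 2 <= (2 / x) ^+ 2) -> (q%:E <= g v)%E) ->
  forall v,
  ((q * ((T^-1 * normal_peak 1) * (eta * T * normal_peak 1) ^+ d.-1 *
    ((eta / T * normal_peak 1) * (eta * normal_peak 1) ^+ d.-1) ^+ n.-1) *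
    expR (- (n%:R * (T ^+ 2 + 4 * d%:R + 30)) / 2))%:E <=
    iter_resample block_keys g v)%E.
Proof.
move=> g0 mg q0 h v.
have len0 k : 0 <= slot_length k.
  rewrite /slot_length; case: ifP => _; case: ifP => _.
  - by rewrite invr_ge0 ltW.
  - by rewrite mulr_ge0 ?ltW.
  - by rewrite divr_ge0 ?ltW.
  - exact: ltW.
have := @iter_resample_boxes R _ draw_rank slot_start slot_length g q
  block_keys g0 mg len0 q0 slot_start_dep uniq_block_keys pairwise_block_keys v
  (n%:R * (T ^+ 2 + 4 * d%:R + 30)).
rewrite (_ : \prod_(k <- block_keys) _ = (T^-1 * normal_peak 1) *
  (eta * T * normal_peak 1) ^+ d.-1 *
  ((eta / T * normal_peak 1) * (eta * normal_peak 1) ^+ d.-1) ^+ n.-1).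
  apply => v' _ box.
  have box' k : (k.1 < n)%N ->
      slot_start k v' <= v' k <= slot_start k v' + slot_length k.
    by move=> kn; apply: box; rewrite mem_block_keys.
  split; first exact: block_sum_sqr.
  by apply: h; exact: block_preimage.
rewrite (perm_big [seq k : K <- enum {: K} | (k.1 < n)%N]) ?perm_sort//=.
rewrite big_filter big_enum_cond /=.
have -> : \prod_(k : K | (k.1 < n)%N) (slot_length k * normal_peak 1) =
    \prod_(i < D | (i < n)%N) \prod_j (slot_length (i, j) * normal_peak 1).
  by rewrite pair_big; apply: eq_big => -[i j] //=; rewrite andbT.
have prod_row (A B : R) : \prod_(j < d) (if j == c0 then A else B) = A * B ^+ d.-1.
  rewrite (bigD1 c0)//= eqxx; congr (_ * _).
  rewrite (eq_bigr (fun=> B)); last by move=> j /negbTE ->.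
  by rewrite prodr_const cardC1 card_ord.
rewrite (bigD1 r0)//=; congr (_ * _).
  rewrite -prod_row; apply: eq_bigr => j _.
  by rewrite /slot_length /= eqxx; case: ifP.
rewrite (eq_bigr (fun=> (eta / T * normal_peak 1) * (eta * normal_peak 1) ^+ d.-1)).
  rewrite prodr_const; congr (_ ^+ _).
  have cn : #|[pred i : 'I_D | (i < n)%N]| = n.
    by rewrite -sum1_card -(big_ord_widen _ (fun=> 1%N) nD) sum1_card card_ord.
  have := cardD1 r0 [pred i : 'I_D | (i < n)%N].
  rewrite cn inE r0n add1n => /(congr1 predn)/= cn'; rewrite [RHS]cn'.
  by apply: eq_card => i; rewrite !inE andbC.
move=> i /andP[_ /negbTE ir0]; rewrite -prod_row; apply: eq_bigr => j _.
by rewrite /slot_length /= ir0; case: ifP.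
Qed.

End GoodBlock.

(** * The lower bound and its rate *)

Section CoreBound.
Variables (R : realType) (D d n : nat).
Local Notation K := ('I_D * 'I_d)%type.
Local Notation V := (vecspace R K).

Definition high_rows : seq 'I_D := [seq i : 'I_D <- enum 'I_D | (n <= i)%N].

Lemma size_high_rows : size high_rows = (D - n)%N.
Proof.
rewrite size_filter -(count_map val (leq n)) val_enum_ord.
elim: D => [|k IH]; first by rewrite sub0n.
rewrite -addn1 iotaD count_cat IH /= addn0 add0n addn1.
case: leqP => h; first by rewrite addn1 subSn.
by rewrite addn0; move: (h) (ltnW h); rewrite -!subn_eq0 => /eqP -> /eqP ->.
Qed.

(** The top block is drawn first and yields a short [y]. It is scaled by [lam], which keeps it
    short, and is then frozen while the lower rows are drawn; these draws leave the top rows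
    unchanged. *)
Lemma core_bound (S : set V) (p : 'I_D -> R) (r0 : 'I_D) (c0 : 'I_d)
    (a : 'I_D -> R) (lam x T : R) :
  measurable S -> (r0 < n)%N -> (n <= D)%N -> (n <= d)%N -> r0 = c0 :> nat ->
  (forall i, `|a i| <= 1) -> a r0 = 1 -> `|lam| <= 1 ->
  0 < x -> 0 < T -> T ^+ 2 = x ^+ 2 + 4 * n%:R ->
  expR (- x ^+ 2 / 2) / x <= 1 ->
  (forall i, `|p i| <= 1) ->
  (forall (v : V) (y : 'I_d -> R),
    (forall i : 'I_D, (i < n)%N -> \sum_j v (i, j) * y j = lam * (2 * a i)) ->
    (forall i : 'I_D, (n <= i)%N -> -1 <= p i + \sum_j y j * v (i, j) <= 1) ->
    S v) ->
  let eta := (2 * d%:R)^-1 : R in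
  forall v,
  (((2^-1 * (1 - expR (- x ^+ 2 / 2) / x)) ^+ (D - n) *
    ((T^-1 * normal_peak 1) * (eta * T * normal_peak 1) ^+ d.-1 *
    ((eta / T * normal_peak 1) * (eta * normal_peak 1) ^+ d.-1) ^+ n.-1) *
    expR (- (n%:R * (T ^+ 2 + 4 * d%:R + 30)) / 2))%:E <=
    iter_resample (block_keys n r0 c0 ++ row_keys d high_rows)
      (EFin \o \1_S) v)%E.
Proof.
move=> mS r0n nD nd rc0 a1 ar0 lam1 x0 T0 T2 ex p1 hS eta v.
have d0 : (0 < d)%N by apply: leq_ltn_trans (ltn_ord c0).
have g0 (w : V) : (0 <= (EFin \o (\1_S : V -> R)) w)%E by rewrite lee_fin.
have mg : measurable_fun setT (EFin \o \1_S : V -> \bar R).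
  exact/measurable_EFinP/measurable_indic.
rewrite iter_resample_cat.
set q := 2^-1 * _.
have q0 : 0 <= q by rewrite mulr_ge0// subr_ge0.
have eta0 : 0 < eta by rewrite invr_gt0 mulr_gt0 ?ltr0n.
have deta : d%:R * eta <= 2^-1.
  by rewrite /eta invfM mulrCA divff ?mulr1// pnatr_eq0 -lt0n.
apply: (@iter_resample_block R D d n r0 c0 a x T eta) => //.
- exact: iter_resample_ge0.
- exact: measurable_iter_resample.
- exact: exprn_ge0.
move=> w [y [By y2]].
rewrite -size_high_rows.
apply: (iter_resample_rows (lo := -1) (hi := 1) (y := fun j => lam * y j) (c := p)) => //.
- by rewrite filter_uniq// enum_uniq.
- move=> i _; rewrite /slab_mass.
  set s2 := \sum_j _.
  have s20 : 0 <= s2 by apply: sumr_ge0 => j _; exact: sqr_ge0.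
  have s2x : s2 <= (2 / x) ^+ 2.
    apply: le_trans y2; apply: ler_sum => j _.
    rewrite exprMn ler_piMl ?sqr_ge0// -(real_normK (num_real lam)) expr_le1//.
  (* If [lam * y] is zero the row stays at [p i], which lies in the interval, so the mass is 1. *)
  case: eqVneq => [_|s2n].
    rewrite lee_fin indicE mem_set /=; last by rewrite in_itv/= -ler_norml.
    have : 0 <= expR (- x ^+ 2 / 2) / x by rewrite divr_ge0 ?expR_ge0 ?ltW.
    by rewrite /q mulr1n; lra.
  apply: normal_prob_unit_ge => //; first by rewrite sqrtr_gt0 lt_neqAle eq_sym s2n.
  rewrite -ler_pdivlMr// -(@ler_pXn2r _ 2) ?nnegrE ?sqrtr_ge0 ?divr_ge0 ?(ltW x0)//.
  by rewrite sqr_sqrtr.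
move=> w' agr wI; rewrite lee_fin indicE mem_set//=.
apply: (hS w' (fun j => lam * y j)) => i lin.
  rewrite -By// mulr_sumr; apply: eq_bigr => j _; rewrite agr; first by rewrite mulrCA.
  by rewrite mem_row_keys mem_filter leqNgt lin.
by apply: wI; rewrite mem_filter lin mem_enum.
Qed.

End CoreBound.

Local Ltac positivity :=
  repeat first [assumption | by rewrite ltr0n | exact: expR_gt0 |
    apply: mulr_gt0 | rewrite invr_gt0 | apply: exprn_gt0].

(** * Choice of x and T, and the resulting order of magnitude *)

Section ScaleChoice.
Variable R : realType.
Implicit Types (x t L : R).

Lemma bernoulli_ineq t (m : nat) : 0 <= t <= 1 -> 1 - m%:R * t <= (1 - t) ^+ m.
Proof.
move=> /andP[t0 t1]; elim: m => [|m IH]; first by rewrite mul0r subr0 expr0.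
rewrite exprS; apply: le_trans (ler_wpM2l _ IH); last by rewrite subr_ge0.
have := mulr_ge0 (ler0n R m) (mulr_ge0 t0 t0).
by rewrite -natr1; nra.
Qed.

Lemma ln_natS_ge_half (m : nat) : (0 < m)%N -> 2^-1 <= ln (m.+1%:R : R).
Proof.
move=> m0; apply: (@le_trans _ _ (ln (2 : R))); last first.
  by rewrite ler_ln ?posrE ?ltr0n// ler_nat.
have := @le_ln1Dx R (- 2^-1).
rewrite (_ : 1 - 2^-1 = 2^-1); last by field.
rewrite lnV ?posrE// lerN2; apply.
by rewrite ltrN2 invf_lt1// ltr1n.
Qed.

Lemma ln_half_sqr L : 0 < L -> expR (ln L / 2) ^+ 2 = L.
Proof.
by move=> L0; rewrite expr2 -expRD -splitr lnK ?posrE.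
Qed.

Section Fixed.
Variables (n d : nat).
Hypotheses (n0 : (0 < n)%N) (d0 : (0 < d)%N).

Let eta : R := (2 * d%:R)^-1.
Let kappa : R := normal_peak 1.
Let kT : R := 8 + 8 * n%:R.

(** The first factor bounds (1 - t)^m, and the product collects the interval lengths without their
    powers of T. The exponentials are what the density retains besides s^n / (m + 1)^n, and
    [kT ^+ n] pays for replacing T by s. *)
Definition success_const : R :=
  2^-1 * (kappa * (eta * kappa) ^+ d.-1 *
    ((eta * kappa) * (eta * kappa) ^+ d.-1) ^+ n.-1) *
  expR (- (n%:R * (4 * n%:R + 4 * d%:R + 30)) / 2) * (expR (- n%:R) / kT ^+ n).

Lemma success_const_gt0 : 0 < success_const.
Proof.
have e0 : 0 < eta by rewrite /eta invr_gt0 mulr_gt0// ltr0n.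
have k0 : 0 < kappa by rewrite normal_peak_gt0// oner_eq0.
have kT0 : 0 < kT by rewrite /kT ltr_wpDr// mulr_ge0.
by rewrite /success_const; positivity.
Qed.

Lemma scale_choice (m : nat) : (0 < m)%N ->
  let s := expR (ln (ln (m.+1%:R : R)) / 2) in
  exists x T : R,
  [/\ 0 < x, 0 < T, T ^+ 2 = x ^+ 2 + 4 * n%:R, expR (- x ^+ 2 / 2) / x <= 1 &
  success_const * (s ^+ d.-1 / (2 ^+ m * m.+1%:R ^+ n)) <=
  (2^-1 * (1 - expR (- x ^+ 2 / 2) / x)) ^+ m *
    ((T^-1 * normal_peak 1) * (eta * T * normal_peak 1) ^+ d.-1 *
    ((eta / T * normal_peak 1) * (eta * normal_peak 1) ^+ d.-1) ^+ n.-1) *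
    expR (- (n%:R * (T ^+ 2 + 4 * d%:R + 30)) / 2)].
Proof.
move=> m0; cbv zeta; set L := ln (m.+1%:R : R); set s := expR (ln L / 2).
have L12 : 2^-1 <= L by exact: ln_natS_ge_half.
have L0 : 0 < L by apply: lt_le_trans L12.
have s0 : 0 < s by exact: expR_gt0.
have s2 : s ^+ 2 = L by exact: ln_half_sqr.
have n1 : (1 : R) <= n%:R by rewrite ler1n.
have lnL1 : ln L <= L - 1.
  by have := @le_ln1Dx R (L - 1); rewrite subrKC; apply; lra.
have lnL2 : - 1 <= ln L.
  apply: (@le_trans _ _ (ln (2^-1 : R))); last by rewrite ler_ln ?posrE.
  by rewrite lnV ?posrE// lerN2; have := @le_ln1Dx R 1; apply; lra.
(* This choice makes exp (- x^2 / 2) equal to sqrt L / (e (m + 1)), so that the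
   factor (1 - exp (- x^2 / 2) / x)^m stays bounded away from 0. *)
pose x2 := 2 * L - ln L + 2.
pose x := Num.sqrt x2.
have x2L : L <= x2 by rewrite /x2; lra.
have xE : x ^+ 2 = x2 by rewrite sqr_sqrtr//; lra.
have x0 : 0 < x by rewrite sqrtr_gt0; lra.
pose T2 := x2 + 4 * n%:R.
pose T := Num.sqrt T2.
have TE : T ^+ 2 = T2 by rewrite sqr_sqrtr// /T2; lra.
have T0 : 0 < T by rewrite sqrtr_gt0 /T2; lra.
have sx : s <= x by rewrite -(@ler_pXn2r _ 2) ?nnegrE ?(ltW s0) ?(ltW x0)// s2 xE.
have sT : s <= T.
  by rewrite -(@ler_pXn2r _ 2) ?nnegrE ?(ltW s0) ?(ltW T0)// s2 TE /T2; lra.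
have kT1 : 1 <= kT by rewrite /kT; lra.
have kT0 : 0 < kT by lra.
(* Since L >= 1 / 2, the constant terms of T^2 are bounded by multiples of L; this gives T^2 <= kT
   L, and kT >= 1. *)
have Ts : T <= kT * s.
  rewrite -(@ler_pXn2r _ 2) ?nnegrE ?(ltW T0) ?mulr_ge0 ?(ltW s0)//; last by lra.
  rewrite exprMn s2 TE; apply: (@le_trans _ _ (kT * L)).
    have : n%:R <= 2 * n%:R * L by rewrite -mulrA mulrCA ler_peMr//; lra.
    by rewrite /T2 /x2 /kT; lra.
  by rewrite ler_wpM2r ?(ltW L0)// expr2 ler_peMr//; lra.
have m1 : (0 : R) < m.+1%:R by rewrite ltr0n.
have eE : expR (- x ^+ 2 / 2) = s * expR (- 1) / m.+1%:R.
  rewrite xE (_ : - x2 / 2 = ln L / 2 + - 1 + - L); last by rewrite /x2; lra.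
  by rewrite !expRD expRN lnK ?posrE.
pose t := expR (- x ^+ 2 / 2) / x.
have t0 : 0 <= t by rewrite divr_ge0 ?expR_ge0 ?(ltW x0).
have e12 : expR (- 1) <= 2^-1 :> R.
  by rewrite expRN lef_pV2 ?posrE ?expR_gt0//; have := @expR_ge1Dx R 1; lra.
have tm : t <= 2^-1 / m.+1%:R.
  rewrite /t eE ler_pdivrMr// [leRHS]mulrAC ler_wpM2r ?invr_ge0 ?(ltW m1)//.
  by rewrite mulrC ler_pM ?expR_ge0 ?(ltW s0).
have t1 : t <= 1.
  apply: le_trans tm _; rewrite ler_pdivrMr// mul1r.
  by apply: (@le_trans _ _ 1); [lra|rewrite ler1n].
exists x, T; split => //; first by rewrite TE xE.
rewrite -/t exprMn.
(* Bernoulli's inequality applies because m t <= 1 / 2. *)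
have tq : 2^-1 <= (1 - t) ^+ m.
  have := @bernoulli_ineq t m; rewrite t0 t1 => /(_ isT); apply: le_trans.
  have : m%:R * t <= 2^-1.
    apply: (@le_trans _ _ (m.+1%:R * (2^-1 / m.+1%:R))).
      by rewrite ler_pM// ler_nat.
    by rewrite mulrCA divff ?mulr1// gt_eqF.
  by lra.
have e0 : 0 < eta by rewrite /eta invr_gt0 mulr_gt0// ltr0n.
have k0 : 0 < kappa by rewrite normal_peak_gt0// oner_eq0.
pose E0 := expR (- (n%:R * (4 * n%:R + 4 * d%:R + 30)) / 2) : R.
have EE : expR (- (n%:R * (T ^+ 2 + 4 * d%:R + 30)) / 2) =
    E0 * (s ^+ n * expR (- n%:R) / m.+1%:R ^+ n).
  rewrite TE /T2 -xE (_ : - _ / 2 =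
    - (n%:R * (4 * n%:R + 4 * d%:R + 30)) / 2 + n%:R * (- x ^+ 2 / 2)); last by lra.
  have en : expR (- 1 : R) ^+ n = expR (- n%:R) by rewrite -expRM_natl mulrN1.
  by rewrite expRD -/E0 expRM_natl eE !exprMn exprVn en.
pose C1 := kappa * (eta * kappa) ^+ d.-1 *
  ((eta * kappa) * (eta * kappa) ^+ d.-1) ^+ n.-1.
have C10 : 0 < C1 by rewrite /C1; positivity.
have CE : (T^-1 * normal_peak 1) * (eta * T * normal_peak 1) ^+ d.-1 *
    ((eta / T * normal_peak 1) * (eta * normal_peak 1) ^+ d.-1) ^+ n.-1 =
    C1 * (T ^+ d.-1 / T ^+ n).
  have Tn : T ^+ n = T * T ^+ n.-1 by rewrite -exprS prednK.
  rewrite -/kappa Tn invfM -exprVn /C1.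
  move: (T^-1) => iT.
  have -> : eta * T * kappa = T * (eta * kappa) by ring.
  have -> : eta * iT * kappa * (eta * kappa) ^+ d.-1 =
    (eta * kappa * (eta * kappa) ^+ d.-1) * iT by ring.
  by rewrite !(exprMn _ T) !(exprMn _ _ iT); ring.
(* The numerator is bounded below through s <= T and the denominator above through T <= kT s. The
   s^n left in the denominator cancels against the one in [EE], so that only s^(d - 1) survives. *)
have TT : s ^+ d.-1 / (kT ^+ n * s ^+ n) <= T ^+ d.-1 / T ^+ n.
  rewrite ler_pM//.
  - by apply: ltW; positivity.
  - by apply: ltW; positivity.
  - by rewrite lerXn2r ?nnegrE ?(ltW s0) ?(ltW T0).
  rewrite lef_pV2 ?posrE; [|by positivity..].
  by rewrite -exprMn lerXn2r ?nnegrE ?(ltW T0)// mulr_ge0 ?(ltW s0) ?(ltW kT0).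
rewrite CE EE.
have sn : s ^+ n != 0 by rewrite expf_neq0// gt_eqF.
have E00 : 0 < E0 by exact: expR_gt0.
apply: (@le_trans _ _ ((2^-1 ^+ m * 2^-1) * (C1 * (s ^+ d.-1 / (kT ^+ n * s ^+ n))) *
   (E0 * (s ^+ n * expR (- n%:R) / m.+1%:R ^+ n)))).
  rewrite /success_const -/C1 -/E0 exprVn !invfM.
  have ss : s ^+ n * (s ^+ n)^-1 = 1 by rewrite divff.
  move: ss; move: (s ^+ n) (s ^+ n)^-1 (kT ^+ n)^-1 (2 ^+ m)^-1 (m.+1%:R ^+ n)^-1
    (s ^+ d.-1) (expR (- n%:R)) => S iS ik i2 im sP e ss.
  rewrite [leRHS](_ : _ = 2^-1 * C1 * E0 * (e * ik) * (sP * (i2 * im)) * (S * iS));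
    last by ring.
  by rewrite ss mulr1.
apply: ler_wpM2r.
  by apply: ltW; positivity.
apply: ler_pM.
- by rewrite mulr_ge0 ?exprn_ge0.
- by apply: ltW; positivity.
- by rewrite ler_wpM2l ?exprn_ge0.
- by rewrite ler_wpM2l ?(ltW C10).
Qed.

End Fixed.
End ScaleChoice.

(** * The objective function and the success event *)

Section EffectiveFunction.
Variables (R : realType) (D n : nat).
Hypothesis nD : (n <= D)%N.

Lemma col_space_memP m (M : 'M[R]_(D, m)) (c : 'I_m -> R) :
  \sum_j c j *: col j M \in col_space M.
Proof.
apply: memv_suml => j _; apply/memvZ/memv_span.
by apply/fintype.imageP; exists j.
Qed.

Lemma eq_on_effective_coords (f : 'cV[R]_D -> R) (T : {vspace 'cV[R]_D}) :
  constant_along_orth f T ->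
  T = col_space (pid_mx n : 'M[R]_(D, n)) ->
  orth_compl T = [set x | x \in col_space (copid_cols R D n)] ->
  forall x x' : 'cV[R]_D,
  (forall i : 'I_D, (i < n)%N -> x i ord0 = x' i ord0) -> f x = f x'.
Proof.
move=> fT TE orthE.
pose top (x : 'cV[R]_D) : 'cV[R]_D := \col_i (if (i < n)%N then x i ord0 else 0).
suff fE x : f x = f (top x).
  move=> x x' xx'; rewrite fE [RHS]fE; congr f; apply/colP => i; rewrite !mxE.
  by case: ifP => // /xx'.
have topT : top x \in T.
  rewrite TE (_ : top x = \sum_j x (widen_ord nD j) ord0 *: col j (pid_mx n)).
    exact: col_space_memP.
  apply/colP => i; rewrite summxE mxE; case: ifPn => lin.
    rewrite (bigD1 (Ordinal lin))//= big1 => [|j ji].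
      rewrite addr0 !mxE eqxx lin mulr1; congr (x _ _); exact: val_inj.
    rewrite !mxE (_ : (i == j :> nat) = false) ?mulr0//.
    by apply/negbTE; apply: contra ji => /eqP ij; apply/eqP/val_inj.
  rewrite big1// => j _; rewrite !mxE (_ : (i == j :> nat) = false) ?mulr0//.
  by apply/negbTE; apply: contra lin => /eqP ->; exact: ltn_ord.
have botT : orth_compl T (x - top x).
  rewrite orthE /= (_ : x - top x = \sum_(j < D - n)
      x (cast_ord (subnKC nD) (rshift n j)) ord0 *: col j (copid_cols R D n)).
    exact: col_space_memP.
  apply/colP => i; rewrite summxE !mxE; case: ifPn => lin.
    rewrite subrr big1// => j _; rewrite !mxE (_ : (i == n + j :> nat)%N = false) ?mulr0//.
    by apply/negbTE; rewrite neq_ltn (leq_trans lin)// leq_addr.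
  rewrite subr0; rewrite -leqNgt in lin.
  have iD : (i - n < D - n)%N by rewrite ltn_sub2r// (leq_ltn_trans lin).
  rewrite (bigD1 (Ordinal iD))//= big1 => [|j ji].
    have e1 : copid_cols R D n i (Ordinal iD) = 1.
      by rewrite mxE (_ : (_ == _) = true)//; apply/eqP; exact: esym (subnKC lin).
    rewrite addr0 mxE [col _ _ _ _]mxE e1 mulr1; congr (x _ _).
    by apply: val_inj; rewrite /= subnKC.
  rewrite !mxE (_ : (i == n + j :> nat)%N = false) ?mulr0//.
  apply/negbTE; apply: contra ji => /eqP ij; apply/eqP/val_inj => /=.
  by rewrite ij addKn.
by rewrite -(fT _ _ topT botT) subrKC.
Qed.

End EffectiveFunction.

Section Success.
Variables (R : realType) (D d : nat).

Lemma exists_box_minimum (f : 'cV[R]_D -> R) : continuous f ->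
  exists2 x : 'cV[R]_D, box x & forall x', box x' -> f x <= f x'.
Proof.
move=> cf.
pose A := [set v : 'rV[R]_D | forall i, `[-1, 1]%classic (v ord0 i)].
have cA : compact A.
  exact: (@rV_compact R D (fun=> `[-1, 1]%classic) (fun=> @segment_compact R _ _)).
have ctr : continuous (fun v : 'rV[R]_D => v^T).
  apply: continuous_entries => i j.
  rewrite (_ : (fun _ => _) = (fun v : 'rV[R]_D => v j i)).
    exact: coord_continuous.
  by apply/funext => v; rewrite mxE.
have A0 : A !=set0.
  by exists 0 => i /=; rewrite mxE in_itv/= lerN10 ler01.
have [|v vA vmin] := @compact_EVT_min _ R (fun v : 'rV[R]_D => f v^T) A A0 cA.
  apply: continuous_subspaceT => v; apply: continuous_comp; first exact: ctr.
  exact: cf.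
exists v^T.
  by move=> i; rewrite mxE; move: vA; rewrite inE => /(_ i) /=; rewrite in_itv.
move=> x' bx'; rewrite -[x']trmxK; apply: vmin; rewrite inE => i /=.
by rewrite mxE in_itv/=; exact: bx'.
Qed.

Lemma closed_box : closed (@box R D).
Proof.
rewrite (_ : @box R D = \bigcap_(i in [set: 'I_D])
    (fun x : 'cV[R]_D => x i ord0) @^-1` `[-1, 1]%classic).
  apply: closed_bigI => i _.
  apply: preimage_closed; first by move=> x _; exact: coord_continuous.
  exact: interval_closed.
apply/seteqP; split => x /= h i; first by move=> _ /=; rewrite in_itv; exact: h.
by have := h i I; rewrite /= in_itv.
Qed.

(** The minimum over the box is attained at some [x], so success means that the affine image meets
    the closed set of box points where f equals [f x]. *)
Lemma measurable_success (f : 'cV[R]_D -> R) (p : 'cV[R]_D) : continuous f ->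
  measurable ([set v | RP_successful f (@box R D) p (mx_of v)] :
    set (vecspace R ('I_D * 'I_d)%type)).
Proof.
move=> cf; have [x bx xmin] := exists_box_minimum cf.
rewrite (_ : [set v | _] =
    [set v | exists y, ([set w | f w = f x] `&` @box R D) (mx_of v *m y + p)]).
  apply: measurable_mx_meets; apply: closedI; last exact: closed_box.
  apply: (@preimage_closed _ _ f [set t | t = f x]); first by move=> w _; exact: cf.
  exact: closed_eq.
apply/seteqP; split => v /=.
  move=> [fstar [[x' bx' fx'] lb] [y fy by_]]; exists y; split => //=.
  rewrite fy; apply: le_anti; rewrite lb/=; last by exists x.
  by rewrite -fx'; exact: xmin.
move=> [y [fy by_]]; exists (f x); last by exists y.
split; first by exists x.
by move=> _ [x' bx' <-]; exact: xmin.
Qed.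

End Success.

Section Rate.
Variable R : realType.

Lemma rate_root (d : nat) (L : R) : (0 < d)%N -> 0 < L ->
  L `^ ((d%:R - 1) / 2) = expR (ln L / 2) ^+ d.-1.
Proof.
move=> d0 L0; rewrite /powR gt_eqF// -expRM_natl; congr expR.
rewrite -[in LHS](prednK d0) -natr1 addrK.
by rewrite mulrAC mulrA.
Qed.

(** This serves the case of effective dimension 0, where a multiple of the rate must stay below the
    probability 1. From ln u <= u - 1 at u = L / k follows k ln L <= k ln k + L, so the power of L
    is at most a constant times exp L = D + 1 <= 2^D. *)
Lemma rate0_bounded (d : nat) : exists2 c : R, 0 < c &
  forall D : nat, (0 < D)%N ->
  c * (ln (D.+1%:R : R) `^ ((d%:R - 1) / 2) / 2 ^+ D) <= 1.
Proof.
pose k : R := d%:R + 1.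
pose C := k + k * ln k.
exists (expR (- C)); first exact: expR_gt0.
move=> D D0; set L := ln _; set r := (d%:R - 1) / 2.
have L12 : 2^-1 <= L by exact: ln_natS_ge_half.
have L0 : 0 < L by apply: lt_le_trans L12.
have d0 : (0 : R) <= d%:R by [].
have k1 : 1 <= k by rewrite /k; lra.
have k0 : 0 < k by lra.
have lnk : 0 <= ln k by exact: ln_ge0.
have rk : `|r| <= k by rewrite /r /k ler_norml; apply/andP; split; lra.
have lnL : - 1 <= ln L.
  apply: (@le_trans _ _ (ln (2^-1 : R))); last by rewrite ler_ln ?posrE.
  by rewrite lnV ?posrE// lerN2; have := @le_ln1Dx R 1; apply; lra.
have lnLk : k * ln L <= k * ln k + L.
  have : ln (L / k) <= L / k - 1.
    by have := @le_ln1Dx R (L / k - 1); rewrite subrKC; apply; rewrite ltrBrDr addNr divr_gt0.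
  rewrite ln_div ?posrE// => h.
  have := ler_wpM2l (ltW k0) h; rewrite !mulrBr mulrCA divff ?gt_eqF//; lra.
have main : r * ln L <= C + L.
  have kk : 0 <= k * ln k by rewrite mulr_ge0// ltW.
  (* L may be smaller than 1 and r may be negative. For ln L < 0 the bounds ln L >= -1 and |r| <= k
     suffice. *)
  have [l0|l0] := leP 0 (ln L).
    apply: (@le_trans _ _ (k * ln L)); last by rewrite /C; lra.
    by rewrite ler_wpM2r// (le_trans (ler_norm r)).
  apply: le_trans (ler_norm _) _; rewrite normrM.
  apply: (@le_trans _ _ (k * 1)); last by rewrite /C; lra.
  by rewrite ler_pM// ler_norml lnL (le_trans (ltW l0)).
have p2 : (0 : R) < 2 ^+ D by rewrite exprn_gt0.
rewrite mulrA ler_pdivrMr// mul1r /powR gt_eqF// -expRD.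
apply: (@le_trans _ _ (expR L)); first by rewrite ler_expR; lra.
by rewrite lnK ?posrE ?ltr0n// -natrX ler_nat ltn_expl.
Qed.

End Rate.

Section SuccessProbability.
Variables (R : realType) (D d n : nat).
Hypotheses (n0 : (0 < n)%N) (nd : (n <= d)%N) (nD : (n < D)%N).

(* Up to the scaling by lam, the displacement to the minimizer has a pivot
   coordinate equal to 2 and all others in [[-2, 2]]. *)
Lemma pivot_displacement (z : 'I_D -> R) : (forall i, `|z i| <= 2) ->
  exists (r0 : 'I_D) (a : 'I_D -> R) (lam : R),
  [/\ (r0 < n)%N, forall i, `|a i| <= 1, a r0 = 1, `|lam| <= 1 &
    forall i : 'I_D, (i < n)%N -> z i = lam * (2 * a i)].
Proof.
move=> z2; have D0 : (0 < D)%N by apply: leq_ltn_trans nD.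
have P0 : (Ordinal D0 < n)%N by [].
case: (@Order.TotalTheory.arg_maxP _ _ _ (Ordinal D0)
  (fun i : 'I_D => (i < n)%N) (fun i => `|z i|) P0) => r0 r0n zmax.
have [zr0|zr0] := eqVneq (z r0) 0.
  (* The largest displacement is 0, so all vanish; the direction is arbitrary and [lam] is 0. *)
  exists r0, (fun i => (i == r0)%:R), 0; split => //.
  - by move=> i; rewrite normr_nat; case: (_ == _); rewrite ?ler01.
  - by rewrite eqxx.
  - by rewrite normr0 ler01.
  - move=> i lin; rewrite mul0r; apply/eqP; rewrite -normr_le0.
    by rewrite (le_trans (zmax i lin))// zr0 normr0.
exists r0, (fun i : 'I_D => if (i < n)%N then z i / z r0 else 0), (z r0 / 2); split => //.
- move=> i; case: ifP => lin; last by rewrite normr0 ler01.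
  by rewrite normrM normfV ler_pdivrMr ?normr_gt0// mul1r; exact: zmax.
- by rewrite r0n divff.
- by rewrite normrM normfV (ger0_norm (ler0n R 2)) ler_pdivrMr// mul1r.
- by move=> i lin; rewrite lin; field.
Qed.

Lemma success_probability_ge (f : 'cV[R]_D -> R) (T : {vspace 'cV[R]_D})
    (dO : measure_display) (Omega : measurableType dO)
    (P : probability Omega R) (A : 'M[{RV P >-> R}]_(D, d)) (p : 'cV[R]_D) :
  continuous f -> constant_along_orth f T ->
  T = col_space (pid_mx n : 'M[R]_(D, n)) ->
  orth_compl T = [set x | x \in col_space (copid_cols R D n)] ->
  gaussian_matrix A -> box p ->
  ((success_const R n d *
     (ln ((D - n).+1%:R : R) `^ ((d%:R - 1) / 2) /
       (2 ^+ (D - n) * (D - n).+1%:R ^+ n)))%:E <=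
   P [set w | RP_successful f (@box R D) p (sample A w)])%E.
Proof.
move=> cf fT TE orthE [normalA indepA] bp.
have [xm bx xmin] := exists_box_minimum cf.
pose z (i : 'I_D) := xm i ord0 - p i ord0.
have z2 i : `|z i| <= 2.
  have := bx i; have := bp i => /andP[? ?] /andP[? ?].
  by rewrite ler_norml /z; apply/andP; split; lra.
have [r0 [a [lam [r0n a1 ar0 lam1 zE]]]] := pivot_displacement z2.
have d0 : (0 < d)%N by apply: leq_trans nd.
(* The pivot column gets the index of the pivot row, which fits because n <= d. *)
pose c0 : 'I_d := widen_ord nd (Ordinal r0n).
have Dn0 : (0 < D - n)%N by rewrite subn_gt0.
have [x [t [x0 t0 tE ex lower]]] := @scale_choice R n d n0 d0 (D - n) Dn0.
set S := [set v | RP_successful f (@box R D) p (mx_of v)] :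
  set (vecspace R ('I_D * 'I_d)%type).
have mS : measurable S by exact: measurable_success.
have -> : [set w | RP_successful f (@box R D) p (sample A w)] =
    joint (fun k : 'I_D * 'I_d => A k.1 k.2) @^-1` S.
  apply/seteqP; split => w /=; rewrite /S /= /joint /mx_of /sample //.
have lnD : 0 < ln ((D - n).+1%:R : R).
  by apply: lt_le_trans (ln_natS_ge_half R Dn0); rewrite invr_gt0.
rewrite (rate_root d0 lnD).
apply: (@ge_iter_resample_probability R _ _ _ P
  (fun k : 'I_D * 'I_d => A k.1 k.2) (fun k => @normalA k.1 k.2) indepA
  (block_keys n r0 c0 ++ row_keys d (high_rows D n))) => //.
have cb := @core_bound R D d n S (fun i => p i ord0) r0 c0 a lam x t
  mS r0n (ltnW nD) nd erefl a1 ar0 lam1 x0 t0 tE ex.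
move=> v; apply: le_trans (cb _ _ v).
- by rewrite lee_fin; exact: lower.
- by move=> i; rewrite ler_norml; exact: bp.
move=> {}v y hy hC; rewrite /S /=.
pose w := mx_of v *m (\col_j y j) + p.
have wE i : w i ord0 = \sum_j v (i, j) * y j + p i ord0.
  by rewrite /w mxE mxE; congr (_ + _); apply: eq_bigr => j _; rewrite !mxE.
(* The point reached shares its effective coordinates with the minimizer, so it has the same value
   of f and its top part lies in the box; the lower part is controlled by [hC]. *)
have wtop (i : 'I_D) : (i < n)%N -> w i ord0 = xm i ord0.
  by move=> lin; rewrite wE hy// -zE// /z subrK.
exists (f xm); first by split; [exists xm | move=> _ [x' bx' <-]; exact: xmin].
exists (\col_j y j); rewrite -/w.
  exact: (eq_on_effective_coords (ltnW nD) fT TE orthE wtop).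
move=> i; have [lin|lin] := ltnP i n; first by rewrite wtop.
rewrite wE addrC; under eq_bigr do rewrite mulrC.
exact: hC.
Qed.

End SuccessProbability.

Theorem theorem3p8 (R : realType) (de d : nat) (le_de_d : (de <= d)%N) :
  exists tau : nat -> R,
  [/\ forall D : nat, (de < D)%N -> 0 < tau D,
      tau =Theta_\oo (fun D : nat =>
        ln ((D - de + 1)%N%:R) `^ ((d%:R - 1) / 2)
        / (2 ^+ (D - de) * ((D - de + 1)%N%:R) ^+ de))
    & forall (D : nat) (f : 'cV[R]_D -> R) (T : {vspace 'cV[R]_D})
        (dO : measure_display) (Omega : measurableType dO)
        (P : probability Omega R) (A : 'M[{RV P >-> R}]_(D, d)),
        (de < D)%N ->
        continuous f ->
        effective_dimension f de ->
        effective_subspace f T ->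
        T = col_space (pid_mx de : 'M[R]_(D, de)) ->
        orth_compl T = [set x | x \in col_space (copid_cols R D de)] ->
        gaussian_matrix A ->
        forall p : 'cV[R]_D, box p ->
          ((tau D)%:E <=
             P [set w | RP_successful f (@box R D) p (sample A w)])%E ].
Proof.
pose rate (D : nat) : R := ln ((D - de + 1)%N%:R) `^ ((d%:R - 1) / 2)
  / (2 ^+ (D - de) * ((D - de + 1)%N%:R) ^+ de).
have [c0 c00 c0_le] := @rate0_bounded R d.
(* For de = 0 there is no pivot row; success is then certain, and [c0] only has to keep tau below
   1. *)
pose c := if de == 0 then c0 else success_const R de d.
have c_gt0 : 0 < c.
  rewrite /c; case: eqP => [//|/eqP]; rewrite -lt0n => de0.
  exact: success_const_gt0 (leq_trans de0 le_de_d).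
exists (fun D => c * rate D); split.
- move=> D deD; rewrite mulr_gt0// /rate addn1 divr_gt0 ?mulr_gt0 ?exprn_gt0 ?ltr0n//.
  apply: powR_gt0; apply: lt_le_trans (ln_natS_ge_half R _); first by rewrite invr_gt0.
  by rewrite subn_gt0.
(* One constant serves for both bounds, and they hold for every D, including D <= de where the
   subtraction is truncated. *)
- rewrite eqThetaE qualifE; apply/asboolP; exists (c, c) => /=; first by rewrite c_gt0.
  apply: nearW => D.
  have e : `|c * rate D| = c * `|rate D| by rewrite normrM (gtr0_norm c_gt0).
  by rewrite e.
move=> D f T dO Omega P A deD cf _ [fT _] TE orthE gA p bp.
rewrite /rate addn1 /c.
(* Without effective coordinates f is constant, and y = 0 succeeds for every draw. *)
have [de0|de0] := eqVneq de 0.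
  have allS : [set w | RP_successful f (@box R D) p (sample A w)] = setT.
    apply/seteqP; split => // w _.
    have fE x : f x = f p.
      by apply: (eq_on_effective_coords (ltnW deD) fT TE orthE) => i; rewrite de0.
    exists (f p); first by split; [exists p | move=> _ [x _ <-]; rewrite fE].
    by exists 0; rewrite mulmx0 add0r.
  rewrite allS probability_setT lee_fin de0 subn0 expr0 mulr1.
  by apply: c0_le; exact: leq_ltn_trans deD.
apply: (success_probability_ge _ le_de_d deD cf fT TE orthE gA bp).
by rewrite lt0n.
Qed.
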